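(* Let $G$ be an abelian group with a translation invariant metric $d$ such that $(G,d)$ is separable and complete. (1) For every convex Markovian convolution semigroup $(\mathcal S(t))_{t\ge 0}$ on $\mathrm{BUC}(G)$ which is continuous from above, there exist a convex expectation space $(\Omega,\mathcal F,\mathcal E)$ and an $\mathcal E$-Lévy process $(X_t)_{t\ge 0}$ with values in $G$ such that $$(\mathcal S(t)f)(x)=\mathcal E(f(x+X_t))\qquad ( * )$$ for every $t\ge 0$, $f\in \mathrm{BUC}(G)$ and $x\in G$. (2) Conversely, for every $G$-valued $\mathcal E$-Lévy process $(X_t)_{t\ge 0}$ on a convex expectation space $(\Omega,\mathcal F,\mathcal E)$, the family $(\mathcal S(t))_{t\ge 0}$ defined by $( * )$ is a convex Markovian convolution semigroup on $\mathrm{BUC}(G)$.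
   Context: $C_b(G)$ and $\mathrm{BUC}(G)$ denote the spaces of bounded continuous, respectively bounded uniformly continuous, functions $G\to\mathbb R$, with supremum norm $\|\cdot\|_\infty$. Inequalities, monotone limits ($\nearrow$, $\searrow$) of functions are pointwise. $\mathcal L^\infty(\Omega,\mathcal F)$ is the space of bounded measurable functions $\Omega\to\mathbb R$. A convex expectation on a convex set $M$ of real functions containing the constants is a map $\mathcal E:M\to\mathbb R$ with: $\mathcal E(X)\le\mathcal E(Y)$ whenever $X\le Y$; $\mathcal E(\alpha)=\alpha$ for all $\alpha\in\mathbb R$; $\mathcal E(\lambda X+(1-\lambda)Y)\le\lambda\mathcal E(X)+(1-\lambda)\mathcal E(Y)$ for $\lambda\in[0,1]$. A convex expectation space $(\Omega,\mathcal F,\mathcal E)$ is a measurable space $(\Omega,\mathcal F)$ with a convex expectation $\mathcal E:\mathcal L^\infty(\Omega,\mathcal F)\to\mathbb R$ which is continuous from below, i.e. $\mathcal E(X_n)\nearrow\mathcal E(X)$ for every increasing sequence $(X_n)$ in $\mathcal L^\infty(\Omega,\mathcal F)$ converging pointwise to $X\in\mathcal L^\infty(\Omega,\mathcal F)$. $G$ carries its Borel $\sigma$-algebra. The distribution of a measurable $X:\Omega\to G$ under $\mathcal E$ is $\mathcal E\circ X^{-1}:C_b(G)\to\mathbb R$, $f\mapsto\mathcal E(f(X))$. For a random variable $Y:\Omega\to S$ with values in a Polish space $S$, $X$ is called independent of $Y$ if $\mathcal E(f(Y,X))=\mathcal E\big(\mathcal E(f(y,X))|_{y=Y}\big)$ for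 all $f\in C_b(S\times G)$ (here $y\mapsto\mathcal E(f(y,X))$ is bounded and lower semicontinuous, so the right-hand side is well defined). A convex kernel is a map $\mathcal S:\mathrm{BUC}(G)\to\mathrm{BUC}(G)$ such that $f\mapsto(\mathcal Sf)(x)$ is a convex expectation on $\mathrm{BUC}(G)$ for every $x\in G$; it is continuous from above if $\mathcal Sf_n\searrow\mathcal Sf$ for every decreasing sequence $(f_n)$ in $\mathrm{BUC}(G)$ converging pointwise to $f\in\mathrm{BUC}(G)$. A convex kernel is a convex Markovian convolution if $\mathcal Sf_n\nearrow\mathcal Sf$ for every increasing sequence $(f_n)$ in $\mathrm{BUC}(G)$ converging pointwise to $f\in\mathrm{BUC}(G)$, and $(\mathcal Sf)(x)=(\mathcal Sf_x)(0)$ for all $f\in\mathrm{BUC}(G)$, $x\in G$, where $f_x(y):=f(x+y)$. A convex Markovian convolution semigroup on $\mathrm{BUC}(G)$ is a family $(\mathcal S(t))_{t\ge0}$ such that (i) each $\mathcal S(t)$ is a convex Markovian convolution; (ii) $\mathcal S(0)f=f$; (iii) $\mathcal S(s+t)=\mathcal S(s)\mathcal S(t)$ for all $s,t\ge0$; (iv) $\lim_{t\searrow0}\|\mathcal S(t)f-f\|_\infty=0$ for all $f\in\mathrm{BUC}(G)$. It is continuous from above if each $\mathcal S(t)$ is. Given a convex expectation space $(\Omega,\mathcal F,\mathcal E)$, a family $(X_t)_{t\ge0}$ is a ($G$-valued) $\mathcal E$-Lévy process if (i) each $X_t:\Omega\to G$ is measurable; (ii) $\mathcal E(f(X_0))=f(0)$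 for all $f\in C_b(G)$; (iii) $\mathcal E\circ(X_{s+t}-X_s)^{-1}=\mathcal E\circ X_t^{-1}$ for all $s,t\ge0$; (iv) $X_{s+t}-X_s$ is independent of $(X_{t_1},\dots,X_{t_n})$ for all $s,t\ge0$, $n\in\mathbb N$, $0\le t_1<\dots<t_n\le s$; (v) $\mathcal E(f(X_t))\to f(0)$ as $t\searrow0$ for all $f\in C_b(G)$. *)

(* Defs.v *)
From HB Require Import structures.
From mathcomp Require Import all_boot all_order all_algebra.
From mathcomp Require Import all_classical all_reals all_analysis.
Set Implicit Arguments.
Unset Strict Implicit.
Unset Printing Implicit Defensive.
Import Order.TTheory GRing.Theory Num.Theory.
Import numFieldNormedType.Exports.
Local Open Scope classical_set_scope.
Local Open Scope ring_scope.

Record invariantMetricGroup (R : realType) := InvariantMetricGroup {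
  group_zmod : zmodType ;
  group_dist : group_zmod -> group_zmod -> R ;
  group_distxx : forall x, group_dist x x = 0 ;
  group_dist_positivity : forall x y, group_dist x y = 0 -> x = y ;
  group_dist_sym : forall x y, group_dist x y = group_dist y x ;
  group_dist_triangle : forall y x z,
    group_dist x z <= group_dist x y + group_dist y z ;
  group_dist_invariant : forall x y z,
    group_dist (x + z) (y + z) = group_dist x y
}.

(* Once normed modules are loaded, Hierarchy Builder refuses a structure joining
   [Metric] and [GRing.Zmodule]; the two structures are put on this type alias
   instead. Nonnegativity of the distance is derived by [isMetric]. *)
Definition group_carrier (R : realType) (G : invariantMetricGroup R) : Type :=
  group_zmod G.
Coercion group_carrier : invariantMetricGroup >-> Sortclass.

HB.instance Definition _ (R : realType) (G : invariantMetricGroup R) :=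
  GRing.Zmodule.copy (group_carrier G) (group_zmod G).
HB.instance Definition _ (R : realType) (G : invariantMetricGroup R) :=
  isPointed.Build (group_carrier G) 0.
HB.instance Definition _ (R : realType) (G : invariantMetricGroup R) :=
  isMetric.Build R (group_carrier G) (@group_distxx R G)
    (@group_dist_positivity R G) (@group_dist_sym R G)
    (@group_dist_triangle R G).

Definition separable (T : topologicalType) : Prop :=
  exists A : set T, countable A /\ dense A.

(* The axiom of the library's [completeType], as a hypothesis. *)
Definition complete (T : puniformType) : Prop :=
  forall F : set_system T, ProperFilter F -> cauchy F -> cvg F.

Section function_spaces.
Variable R : realType.

Definition Cb (T : topologicalType) : set (T -> R) :=
  [set f : T -> R | continuous f /\ bounded_fun f].

Definition BUC (T : uniformType) : set (T -> R) :=
  [set f : T -> R | unif_continuous f /\ bounded_fun f].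

Definition Linfty (d : measure_display) (T : measurableType d) :
    set (T -> R) :=
  [set f : T -> R | measurable_fun [set: T] f /\ bounded_fun f].

(* Meaningful for bounded [f] only, as [sup] is 0 on unbounded sets. *)
Definition sup_norm (T : Type) (f : T -> R) : R := sup (range (fun x => `|f x|)).

Definition increases_to (u : R ^nat) (l : R) : Prop :=
  nondecreasing_seq u /\ u @ \oo --> l.

Definition decreases_to (u : R ^nat) (l : R) : Prop :=
  nonincreasing_seq u /\ u @ \oo --> l.

End function_spaces.

(* A map defined on a set [M] of real functions is represented by a total map
   on all functions of which only the values on [M] are constrained or used. *)
Section expectations.
Variable R : realType.

Record convex_expectation (T : Type) (M : set (T -> R))
    (E : (T -> R) -> R) : Prop := {
  expectation_monotone : forall X Y, M X -> M Y ->
    (forall w, X w <= Y w) -> E X <= E Y ;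
  expectation_cst : forall a : R, E (cst a) = a ;
  expectation_convex : forall X Y (l : R), M X -> M Y -> 0 <= l <= 1 ->
    E (fun w => l * X w + (1 - l) * Y w) <= l * E X + (1 - l) * E Y
}.

Record convex_expectation_space (d : measure_display) (Omega : measurableType d)
    (E : (Omega -> R) -> R) : Prop := {
  space_expectation : convex_expectation (@Linfty R d Omega) E ;
  space_continuous_from_below : forall (X_ : (Omega -> R) ^nat) (X : Omega -> R),
    (forall n, Linfty (X_ n)) -> Linfty X ->
    (forall w, increases_to (fun n => X_ n w) (X w)) ->
    increases_to (fun n => E (X_ n)) (E X)
}.

Definition law (Omega T : Type) (E : (Omega -> R) -> R) (X : Omega -> T) :
    (T -> R) -> R :=
  fun f => E (fun w => f (X w)).

Definition independent (Omega : Type) (S T : topologicalType)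
    (E : (Omega -> R) -> R) (X : Omega -> T) (Y : Omega -> S) : Prop :=
  forall f : S * T -> R, Cb f ->
    E (fun w => f (Y w, X w)) = E (fun w => E (fun w' => f (Y w, X w'))).

End expectations.

Section semigroups.
Variables (R : realType) (G : invariantMetricGroup R).

Record convex_kernel (S : (G -> R) -> G -> R) : Prop := {
  kernel_BUC : forall f : G -> R, BUC f -> BUC (S f) ;
  kernel_expectation : forall x : G, convex_expectation (@BUC R _) (fun f => S f x)
}.

Definition continuous_from_above (S : (G -> R) -> G -> R) : Prop :=
  forall (f_ : (G -> R) ^nat) (f : G -> R),
    (forall n, BUC (f_ n)) -> BUC f ->
    (forall x, decreases_to (fun n => f_ n x) (f x)) ->
    forall x, decreases_to (fun n => S (f_ n) x) (S f x).

Record convex_Markovian_convolution (S : (G -> R) -> G -> R) : Prop := {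
  convolution_kernel : convex_kernel S ;
  convolution_continuous_from_below :
    forall (f_ : (G -> R) ^nat) (f : G -> R),
      (forall n, BUC (f_ n)) -> BUC f ->
      (forall x, increases_to (fun n => f_ n x) (f x)) ->
      forall x, increases_to (fun n => S (f_ n) x) (S f x) ;
  convolution_translation : forall (f : G -> R) (x : G), BUC f ->
    S f x = S (fun y => f (x + y)) 0
}.

(* Time ranges over all of [R]; only times [t >= 0] are constrained. *)
Record convex_Markovian_convolution_semigroup
    (S : R -> (G -> R) -> G -> R) : Prop := {
  semigroup_convolution : forall t : R, 0 <= t ->
    convex_Markovian_convolution (S t) ;
  semigroup0 : forall f : G -> R, BUC f -> S 0 f = f ;
  semigroupD : forall (s t : R) (f : G -> R), 0 <= s -> 0 <= t -> BUC f ->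
    S (s + t) f = S s (S t f) ;
  semigroup_cvg0 : forall f : G -> R, BUC f ->
    sup_norm (fun x => S t f x - f x) @[t --> 0^'+] --> (0 : R)
}.

End semigroups.

Definition increment (R : realType) (G : invariantMetricGroup R) (Omega : Type)
    (X : R -> Omega -> G) (s t : R) : Omega -> G :=
  fun w => X t w - X s w.

Record Levy_process (R : realType) (G : invariantMetricGroup R)
    (d : measure_display) (Omega : measurableType d)
    (E : (Omega -> R) -> R) (X : R -> Omega -> G) : Prop := {
  Levy_measurable : forall t : R, 0 <= t ->
    measurable_fun [set: Omega] (X t : Omega -> g_sigma_algebraType (open : set (set G))) ;
  Levy0 : forall f : G -> R, Cb f -> law E (X 0) f = f 0 ;
  Levy_stationary : forall s t : R, 0 <= s -> 0 <= t ->
    forall f : G -> R, Cb f ->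
      law E (increment X s (s + t)) f = law E (X t) f ;
  Levy_independent : forall s t : R, 0 <= s -> 0 <= t ->
    forall (n : nat) (ts : 'I_n -> R),
      (forall i : 'I_n, 0 <= ts i <= s) -> (forall i j : 'I_n, (i < j)%N -> ts i < ts j) ->
      independent E (increment X s (s + t))
        (fun w => \row_(i < n) X (ts i) w) ;
  Levy_cvg0 : forall f : G -> R, Cb f ->
    law E (X t) f @[t --> 0^'+] --> f 0
}.

(* Main.v *)
Require Import Defs.
From HB Require Import structures.
From mathcomp Require Import all_boot all_order all_algebra.
From mathcomp Require Import all_classical all_reals all_analysis.
From mathcomp Require Import measurable_realfun ring lra.
Set Implicit Arguments.
Unset Strict Implicit.
Unset Printing Implicit Defensive.
Import Order.TTheory GRing.Theory Num.Theory.
Import numFieldNormedType.Exports.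
Local Open Scope classical_set_scope.
Local Open Scope ring_scope.

(* Part (1). Write [E_t f = (S t f)(0)]. On the path space [R -> G] the iterated
   expectations of the increments give a convex expectation [E0] on the uniformly
   continuous cylinder functions. By Hahn-Banach, [E0] is the maximum of [L - a]
   over the linear expectations [L] and constants [a] with [L - a <= E0]. Continuity
   from above of [S t] makes the one-dimensional marginals of such an [L] tight;
   since [G] is complete, [L] is then continuous along decreasing sequences of
   cylinder functions (Kolmogorov's argument), hence extends to a countably
   additive expectation by Daniell's construction. The supremum of the extended
   [L - a] is the required expectation: a supremum of functionals continuous
   from below is continuous from below. The Levy property is checked on uniformly
   continuous functions and passes to [C_b] along increasing sequences.
   Part (2). Everything follows from cash invariance [E (X + c) = E X + c]; the
   strong continuity is that of [t |-> E (m (X t))] at [0], for the modulus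
   [m y = sup_x |f (x + y) - f x|]. *)

(** [E0] is convex but need not be positively homogeneous, which forces the constants [a]:
    [L <= E0 + a] does not make [L] small where [E0] is small. For [g >= 0] one uses
    [l * L g <= E0 (l * g) + a] with a large [l], so tightness rests on continuity from above along
    multiples of one sequence. Domination is exploited one time at a time; countably many times and
    precisions are combined by summing errors [eta / 2 ^+ i.+1]. Compact sets of paths never appear:
    tightness is stored in Lipschitz functions measuring the distance to finite sets, and the limit
    path is taken coordinatewise along an ultrafilter. The semigroup law enters through the
    well-definedness of [E0]: it makes the iterated expectation independent of the list of times
    chosen for a cylinder function. *)

Ltac intro_lra := intros; lra.
Ltac intro_nra := intros; nra.

(** * Lipschitz approximation and cash invariance *)

Section real_functions.
Variable R : realType.

Lemma bounded_fun_leP (T : Type) (f : T -> R) :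
  bounded_fun f <-> exists C : R, forall x, `|f x| <= C.
Proof.
split=> [[M [Mr MP]]|[C Cf]].
  by exists (M + 1) => x; apply: (MP (M + 1)) => //; rewrite ltrDl.
exists C; split; first exact: num_real.
by move=> M /ltW CM x _; exact: le_trans (Cf x) CM.
Qed.

Lemma inf_range_le (T : Type) (f : T -> R) (c : R) (x : T) :
  (forall y, c <= f y) -> inf (range f) <= f x.
Proof.
by move=> cf; apply: ge_inf; [exists c => _ [y _ <-]|exists x].
Qed.

Lemma inf_range_ge (T : Type) (f : T -> R) (c : R) (x : T) :
  (forall y, c <= f y) -> c <= inf (range f).
Proof.
by move=> cf; apply: lb_le_inf; [exists (f x), x|move=> _ [y _ <-]].
Qed.

Lemma increases_toP (u : R ^nat) (l : R) : increases_to u l <->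
  [/\ nondecreasing_seq u, forall n, u n <= l &
      forall e, 0 < e -> exists n, l - e <= u n].
Proof.
split=> [[und ul]|[und ule ul]].
  split=> //.
    move=> n; rewrite -(cvg_lim _ ul)//.
    by apply: nondecreasing_cvgn_le => //; apply/cvg_ex; exists l.
  move=> e e0; have [N _ HN] := (cvgrPdist_le _ _).1 ul e e0.
  by exists N; have := HN N (leqnn N); rewrite /= ler_norml => /andP[_]; intro_lra.
split=> //; apply/cvgrPdist_le => e e0; have [n ln] := ul e e0.
exists n => // m /= nm; have := ule m; have := und _ _ nm.
by move=> ? ?; rewrite ler_norml; apply/andP; split; intro_lra.
Qed.

Lemma increases_to_unique (u : R ^nat) (l l' : R) :
  increases_to u l -> increases_to u l' -> l = l'.
Proof. by move=> [_ ul] [_ ul']; exact: (cvg_unique _ ul ul'). Qed.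

(* The inf-convolutions [x |-> inf_y (f y + n * D x y)]. *)
Lemma lipschitz_approximation_below (T : Type) (D : T -> T -> R) (f : T -> R) (C : R) :
  (forall x, D x x = 0) -> (forall x y, 0 <= D x y) ->
  (forall x y, D x y = D y x) ->
  (forall x y z, D x z <= D x y + D y z) ->
  (forall x, `|f x| <= C) ->
  (forall x e, 0 < e ->
     exists2 d, 0 < d & forall y, D x y < d -> f x - e <= f y) ->
  exists f_ : nat -> T -> R,
    [/\ forall n x y, `|f_ n x - f_ n y| <= n%:R * D x y,
        forall n x, `|f_ n x| <= C &
        forall x, increases_to (f_^~ x) (f x)].
Proof.
move=> Dxx D0 Dsym Dtri fC fc.
pose g n x y := f y + n%:R * D x y.
have fl y : - C <= f y by have := fC y; rewrite ler_norml => /andP[].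
have fu y : f y <= C by have := fC y; rewrite ler_norml => /andP[].
have gl n x y : - C <= g n x y.
  by rewrite /g (le_trans (fl y))// lerDl mulr_ge0.
have gi n x y : inf (range (g n x)) <= g n x y := inf_range_le y (gl n x).
have ig n x c : (forall y, c <= g n x y) -> c <= inf (range (g n x)).
  exact: inf_range_ge.
exists (fun n x => inf (range (g n x))).
have lef n x : inf (range (g n x)) <= f x.
  by rewrite (le_trans (gi n x x))// /g Dxx mulr0 addr0.
split.
- have half n x y : inf (range (g n x)) - inf (range (g n y)) <= n%:R * D x y.
    rewrite lerBlDr addrC -lerBlDr; apply: (ig) => z; rewrite lerBlDr.
    rewrite (le_trans (gi n x z))// /g -addrA lerD2l -mulrDr addrC.
    exact: ler_wpM2l.
  move=> n x y; rewrite ler_norml half andbT lerNl opprB Dsym; exact: half.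
- move=> n x; rewrite ler_norml; apply/andP; split; first exact: ig.
  exact: le_trans (lef n x) (fu x).
- move=> x; apply/increases_toP; split=> //.
    apply/nondecreasing_seqP => n; apply: ig => y.
    by rewrite (le_trans (gi n x y))// /g lerD2l ler_wpM2r// ler_nat.
  move=> e e0; have [d d0 dP] := fc x e e0.
  (* For this [n], a point [y] at distance at least [d] gives [g n x y >= - C + 2 * C >= f x];
     nearer points are covered by lower semicontinuity. *)
  have [n nC] : exists n : nat, 2 * C / d <= n%:R.
    exists (Num.bound `|2 * C / d|).
    by rewrite (le_trans (ler_norm _))// ltW// archi_boundP.
  exists n; apply: ig => y; rewrite /g.
  have [Dd|Dd] := ltP (D x y) d.
    have := dP y Dd.
    have nD : 0 <= n%:R * D x y by rewrite mulr_ge0.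
    by intro_lra.
  have : 2 * C <= n%:R * D x y.
    rewrite ler_pdivrMr// in nC; apply: (le_trans nC); exact: ler_wpM2l.
  by have := fu x; have := fl y; intro_lra.
Qed.

End real_functions.

Section convex_expectation_theory.
Variables (R : realType) (T : Type) (M : set (T -> R)) (E : (T -> R) -> R).
Hypothesis M_affine : forall (a b : R) X, M X -> M (fun w => a * X w + b).
Hypothesis HE : convex_expectation M E.

Let M_scale a X : M X -> M (fun w => a * X w).
Proof.
by move=> /(M_affine a 0); congr M; apply/funext => w; rewrite addr0.
Qed.

Let M_shift c X : M X -> M (fun w => X w + c).
Proof.
by move=> /(M_affine 1 c); congr M; apply/funext => w; rewrite mul1r.
Qed.

(* Convexity splits [X + c] into [(1 + h) X] and a constant with weights
   [(1 + h)^-1] and [h / (1 + h)], and [(1 + h) X] into [X] and [2 X] with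
   weights [1 - h] and [h]; then [h] tends to [0]. *)
Lemma expectation_shift_le (X : T -> R) (c : R) : M X ->
  E (fun w => X w + c) <= E X + c.
Proof.
move=> MX; pose D := E (fun w => X w + c) - c - E X.
pose K := `|E (fun w => 2 * X w) - 2 * E X| + 1.
have K0 : 0 < K by rewrite /K ltr_wpDl.
suff DK h : 0 < h < 1 -> D <= h * K.
  rewrite leNgt; apply/negP => cX; have D0 : 0 < D by rewrite /D; intro_lra.
  (* This choice gives [h * K < D], contradicting [DK]. *)
  pose h := D / (D + 2 * K).
  have DK0 : 0 < D + 2 * K by intro_lra.
  have h1 : h < 1 by rewrite ltr_pdivrMr//; intro_lra.
  have h0 : 0 < h by rewrite divr_gt0.
  have := DK h; rewrite h0 h1 => /(_ isT); rewrite /h mulrAC ler_pdivlMr//.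
  by intro_nra.
move=> /andP[h0 h1].
have l01 : 0 <= (1 + h)^-1 <= 1.
  by rewrite invr_ge0 invf_le1 ?andbT; intro_lra.
have Mc : M (cst ((1 + h) / h * c)).
  move: (M_affine 0 ((1 + h) / h * c) MX); congr M.
  by apply/funext => w /=; rewrite mul0r add0r.
have h1n : 1 + h != 0 by intro_lra.
have hn : h != 0 by intro_lra.
have := Defs.expectation_convex HE (M_scale (1 + h) MX) Mc l01.
rewrite (Defs.expectation_cst HE).
have -> : (fun w => (1 + h)^-1 * ((1 + h) * X w) +
    (1 - (1 + h)^-1) * cst ((1 + h) / h * c) w) = (fun w => X w + c).
  by apply/funext => w /=; field; rewrite h1n hn.
have -> : (1 - (1 + h)^-1) * ((1 + h) / h * c) = c by field; rewrite h1n hn.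
have h01 : 0 <= h <= 1 by intro_lra.
have := Defs.expectation_convex HE (M_scale 2 MX) MX h01.
have -> : (fun w => h * (2 * X w) + (1 - h) * X w) = (fun w => (1 + h) * X w).
  by apply/funext => w; ring.
move=> H1; rewrite -lerBlDr -(ler_pM2l (_ : 0 < 1 + h)); last intro_lra.
rewrite mulVKf// => H2.
have H3 : E (fun w => 2 * X w) - 2 * E X <= K.
  by rewrite /K (le_trans (ler_norm _))// lerDl.
have : (1 + h) * D <= h * K by rewrite /D; intro_nra.
have [D0|D0] := leP D 0; first by move=> _; apply: (le_trans D0); intro_nra.
by intro_nra.
Qed.

Lemma expectation_shift (X : T -> R) (c : R) : M X ->
  E (fun w => X w + c) = E X + c.
Proof.
move=> MX; apply/le_anti; rewrite expectation_shift_le//=.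
have := expectation_shift_le (- c) (M_shift c MX).
have -> : (fun w => X w + c - c) = X by apply/funext => w; rewrite addrK.
by intro_lra.
Qed.

Lemma expectation_le_shift (X Y : T -> R) (c : R) : M X -> M Y ->
  (forall w, X w <= Y w + c) -> E X <= E Y + c.
Proof.
move=> MX MY XY; rewrite -expectation_shift//.
by apply: (expectation_monotone HE) => //; exact: M_shift.
Qed.

Lemma expectation_dist_le (X Y : T -> R) (c : R) : M X -> M Y ->
  (forall w, `|X w - Y w| <= c) -> `|E X - E Y| <= c.
Proof.
move=> MX MY XY.
have H X' Y' : M X' -> M Y' -> (forall w, `|X' w - Y' w| <= c) -> E X' - E Y' <= c.
  move=> MX' MY' XY'; rewrite lerBlDl.
  by apply: expectation_le_shift => // w; have /ler_normlW := XY' w; intro_lra.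
rewrite ler_norml lerNl opprB !H// => w; by rewrite distrC.
Qed.

End convex_expectation_theory.

(** * Hahn-Banach *)

Section hahn_banach.
Variables (R : realType) (V : lmodType R) (M : set V) (p : V -> R).
Hypothesis M0 : M 0.
Hypothesis MD : forall x y, M x -> M y -> M (x + y).
Hypothesis MZ : forall (a : R) x, M x -> M (a *: x).

(** Homogeneity is asked as an inequality, which is easier to check for infima; equality for
    [a >= 0] follows by scaling back ([qZge]). *)
Definition sublinear_on (q : V -> R) : Prop :=
  (forall x y, M x -> M y -> q (x + y) <= q x + q y) /\
  (forall (a : R) x, 0 <= a -> M x -> q (a *: x) <= a * q x).

Let MN x : M x -> M (- x).
Proof. by rewrite -scaleN1r; exact: MZ. Qed.

Let q0 q : sublinear_on q -> q 0 = 0.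
Proof.
move=> [qD qZ]; apply/le_anti; have := qZ 0 0 (lexx 0) M0.
rewrite scale0r mul0r => -> /=.
by have := qD _ _ M0 M0; rewrite addr0; intro_lra.
Qed.

Let qN q x : sublinear_on q -> M x -> - q (- x) <= q x.
Proof.
move=> sq Mx; have := sq.1 _ _ Mx (MN Mx); rewrite subrr q0//; intro_lra.
Qed.

Let qZge q a x : sublinear_on q -> M x -> 0 <= a -> a * q x <= q (a *: x).
Proof.
move=> sq Mx; rewrite le_eqVlt => /predU1P[<-|a0].
  by rewrite mul0r scale0r q0.
have := sq.2 a^-1 (a *: x); rewrite invr_ge0 (ltW a0) => /(_ isT (MZ a Mx)).
by rewrite scalerK ?gt_eqF// mulrC ler_pdivlMr// mulrC.
Qed.

Definition minimal_sublinear (q : V -> R) : Prop :=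
  sublinear_on q /\
  forall r, sublinear_on r -> (forall x, M x -> r x <= q x) ->
    forall x, M x -> q x <= r x.

(* [z |-> inf_(t >= 0) (q (z + t x) - t q x)] is sublinear and below [q]. *)
Lemma minimal_sublinear_additive q x y : minimal_sublinear q -> M x -> M y ->
  q x + q y <= q (x + y).
Proof.
move=> [sq qmin] Mx My.
have [qD qZ] := sq.
pose g z (t : {t : R | 0 <= t}) := q (z + sval t *: x) - sval t * q x.
pose t0 : {t : R | 0 <= t} := exist _ 0 (lexx 0).
have glb z t : M z -> - q (- z) <= g z t.
  move=> Mz; rewrite /g; case: t => t /= t0'.
  have := qD _ _ (MD Mz (MZ t Mx)) (MN Mz).
  by rewrite addrC addKr; have := qZge sq Mx t0'; intro_lra.
have gi z t : M z -> inf (range (g z)) <= g z t.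
  by move=> Mz; apply: inf_range_le => t'; exact: glb.
have gapp z e : M z -> 0 < e -> exists t, g z t < inf (range (g z)) + e.
  move=> Mz e0; have : has_inf (range (g z)).
    split; first by exists (g z t0), t0.
    by exists (- q (- z)) => _ [t _ <-]; exact: glb.
  by move=> /(inf_adherent e0)[_ [t _ <-]]; exists t.
have sr : sublinear_on (fun z => inf (range (g z))).
  split=> [u v Mu Mv|a u a0 Mu].
    apply/ler_addgt0Pr => e e0; have e20 : 0 < e / 2 by rewrite divr_gt0.
    have [[s s0] /ltW gs] := gapp _ _ Mu e20.
    have [[t t0'] /ltW gt] := gapp _ _ Mv e20.
    apply: (le_trans (gi (u + v) (exist _ (s + t) (addr_ge0 s0 t0')) (MD Mu Mv))).
    move: gs gt; rewrite /g/= scalerDl addrACA.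
    by have := qD _ _ (MD Mu (MZ s Mx)) (MD Mv (MZ t Mx)); intro_lra.
  have [->|an0] := eqVneq a 0.
    rewrite mul0r scale0r (le_trans (gi 0 t0 M0))// /g/= scale0r addr0 mul0r.
    by rewrite q0// subrr.
  have a_gt0 : 0 < a by rewrite lt_def an0.
  apply/ler_addgt0Pr => e e0; have ea0 : 0 < e / a by rewrite divr_gt0.
  have [[s s0] /ltW gs] := gapp _ _ Mu ea0.
  apply: (le_trans (gi (a *: u) (exist _ (a * s) (mulr_ge0 a0 s0)) (MZ a Mu))).
  move: gs; rewrite /g/= -scalerA -scalerDr -(ler_pM2l a_gt0).
  rewrite mulrDr [X in _ <= X]mulrDr [a * (e / a)]mulrC divfK//.
  have := qZ a _ a0 (MD Mu (MZ s Mx)).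
  by rewrite mulrN mulrA; intro_lra.
(* Minimality bounds [q y] by the infimum at [y], and [t = 1] bounds that by [q (y + x) - q x]. *)
have := qmin _ sr _ y My.
have rq z : M z -> inf (range (g z)) <= q z.
  move=> Mz; apply: (le_trans (gi z t0 Mz)).
  by rewrite /g/= scale0r addr0 mul0r subr0.
move=> /(_ rq); have := gi y (exist _ 1 ler01) My.
by rewrite /g/= scale1r mul1r [y + x]addrC; intro_lra.
Qed.

Lemma minimal_sublinear_linear q : minimal_sublinear q ->
  (forall x y, M x -> M y -> q (x + y) = q x + q y) /\
  (forall a x, M x -> q (a *: x) = a * q x).
Proof.
move=> mq; have [sq _] := mq; have [qD qZ] := sq.
have qadd x y : M x -> M y -> q (x + y) = q x + q y.
  move=> Mx My; apply/le_anti; rewrite qD//=.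
  exact: minimal_sublinear_additive.
have qopp x : M x -> q (- x) = - q x.
  move=> Mx; have := qadd _ _ Mx (MN Mx); rewrite subrr q0//; intro_lra.
split=> // a x Mx; have [a0|/ltW a0] := leP 0 a.
  by apply/le_anti; rewrite qZ// qZge.
rewrite -[a]opprK scaleNr qopp; last exact: MZ.
rewrite mulNr; congr (- _); apply/le_anti.
by rewrite qZ ?qZge// oppr_ge0.
Qed.

(** Zorn's lemma yields a minimal sublinear functional below [p], and minimality forces linearity. A
    chain is bounded by its pointwise infimum: of two members nearly optimal at [u] and at [v], the
    smaller one serves both, hence [u + v]. *)
Lemma hahn_banach : sublinear_on p ->
  exists L : V -> R,
    [/\ forall x y, M x -> M y -> L (x + y) = L x + L y,
        forall a x, M x -> L (a *: x) = a * L x &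
        forall x, M x -> L x <= p x].
Proof.
move=> sp.
pose Q := {q : V -> R | sublinear_on q /\ forall x, M x -> q x <= p x}.
pose below (q r : Q) : bool := `[< forall x, M x -> sval r x <= sval q x >].
have [] := @ZL_preorder Q (exist _ p (conj sp (fun x _ => lexx (p x)))) below.
- by move=> q; apply/asboolP.
- move=> r s t /asboolP rs /asboolP st; apply/asboolP => x Mx.
  exact: le_trans (st x Mx) (rs x Mx).
- move=> A Atot; have [[q0' Aq0]|A0] := pselect (exists q, A q); last first.
    exists (exist _ p (conj sp (fun x _ => lexx (p x)))) => s As.
    by exfalso; apply: A0; exists s.
  pose g x (q : {q : Q | A q}) := sval (sval q) x.
  have glb x q : M x -> - p (- x) <= g x q.
    case: q => [[q [sq qp]] Aq] Mx; rewrite /g /=.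
    by apply: le_trans (qN sq Mx); rewrite lerN2; exact: (qp _ (MN Mx)).
  have gi x q : M x -> inf (range (g x)) <= g x q.
    by move=> Mx; apply: inf_range_le => q'; exact: glb.
  have gapp z e : M z -> 0 < e -> exists t, g z t < inf (range (g z)) + e.
    move=> Mz e0; have : has_inf (range (g z)).
      split; first by exists (g z (exist _ q0' Aq0)), (exist _ q0' Aq0).
      by exists (- p (- z)) => _ [t _ <-]; exact: glb.
    by move=> /(inf_adherent e0)[_ [t _ <-]]; exists t.
  have sg : sublinear_on (fun x => inf (range (g x))).
    split=> [u v Mu Mv|a u a0 Mu].
      apply/ler_addgt0Pr => e e0; have e20 : 0 < e / 2 by rewrite divr_gt0.
      have [[s As] /ltW gs] := gapp _ _ Mu e20.
      have [[t At] /ltW gt] := gapp _ _ Mv e20.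
      have [/asboolP st|/asboolP ts] := Atot _ _ As At.
        apply: (le_trans (gi (u + v) (exist _ t At) (MD Mu Mv))).
        move: gs gt; rewrite /g/=.
        have := (svalP t).1.1 _ _ Mu Mv; have := st _ Mu; intro_lra.
      apply: (le_trans (gi (u + v) (exist _ s As) (MD Mu Mv))).
      move: gs gt; rewrite /g/=.
      have := (svalP s).1.1 _ _ Mu Mv; have := ts _ Mv; intro_lra.
    have [->|an0] := eqVneq a 0.
      rewrite mul0r scale0r (le_trans (gi 0 (exist _ q0' Aq0) M0))// /g/=.
      by rewrite q0//; exact: (svalP q0').1.
    have a_gt0 : 0 < a by rewrite lt_def an0.
    rewrite mulrC -ler_pdivrMr//; apply: inf_range_ge => [|[s As]].
      exact: (exist _ q0' Aq0).
    rewrite ler_pdivrMr// mulrC (le_trans (gi _ (exist _ s As) (MZ a Mu)))//.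
    by rewrite /g/=; apply: (svalP s).1.2.
  have gp x : M x -> inf (range (g x)) <= p x.
    move=> Mx; apply: (le_trans (gi x (exist _ q0' Aq0) Mx)); rewrite /g/=.
    exact: (svalP q0').2.
  exists (exist _ (fun x => inf (range (g x))) (conj sg gp)) => s As.
  by apply/asboolP => x Mx /=; exact: (gi x (exist _ s As)).
move=> [q [sq qp]] qmax; exists q.
have mq : minimal_sublinear q.
  split=> // r sr rq.
  have rp x : M x -> r x <= p x by move=> Mx; exact: le_trans (rq x Mx) (qp x Mx).
  by have /asboolP := qmax (exist _ r (conj sr rp)) (introT (asboolP _) rq).
by have [qadd qscale] := minimal_sublinear_linear mq.
Qed.

End hahn_banach.

(** * The Daniell integral *)

Lemma ler_sum_ord (R : numDomainType) (F : nat -> R) m n : (m <= n)%N ->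
  (forall i, 0 <= F i) -> \sum_(i < m) F i <= \sum_(i < n) F i.
Proof.
by move=> mn F0; rewrite -(subnKC mn) big_split_ord/= lerDl sumr_ge0.
Qed.

Section daniell.
Variables (R : realType) (T : Type).

Record function_lattice (M : set (T -> R)) : Prop := {
  lattice_cst : forall c, M (cst c) ;
  lattice_lin : forall a f g, M f -> M g -> M (fun w => a * f w + g w) ;
  lattice_max : forall f g, M f -> M g -> M (fun w => Num.max (f w) (g w)) ;
  lattice_bounded : forall f, M f -> exists C, forall w, `|f w| <= C
}.

Record daniell_functional (M : set (T -> R)) (I : (T -> R) -> R) : Prop := {
  daniell_lin : forall a f g, M f -> M g ->
    I (fun w => a * f w + g w) = a * I f + I g ;
  daniell_le : forall f g, M f -> M g -> (forall w, f w <= g w) -> I f <= I g ;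
  daniell_cst : forall c, I (cst c) = c ;
  daniell_continuous : forall h_ : nat -> T -> R, (forall n, M (h_ n)) ->
    (forall n w, 0 <= h_ n w) -> (forall w, nonincreasing_seq (h_^~ w)) ->
    (forall w e, 0 < e -> exists n, h_ n w <= e) ->
    forall e, 0 < e -> exists n, I (h_ n) <= e
}.

Variables (M : set (T -> R)) (I : (T -> R) -> R).
Hypotheses (HM : function_lattice M) (HI : daniell_functional M I).

Lemma latticeD f g : M f -> M g -> M (fun w => f w + g w).
Proof.
move=> Mf Mg; move: (lattice_lin HM 1 Mf Mg); congr M.
by apply/funext => w; rewrite mul1r.
Qed.

Lemma latticeZ a f : M f -> M (fun w => a * f w).
Proof.
move=> Mf; move: (lattice_lin HM a Mf (lattice_cst HM 0)); congr M.
by apply/funext => w; rewrite addr0.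
Qed.

Lemma latticeN f : M f -> M (fun w => - f w).
Proof.
by move=> /(latticeZ (-1)); congr M; apply/funext => w; rewrite mulN1r.
Qed.

Lemma latticeB f g : M f -> M g -> M (fun w => f w - g w).
Proof. by move=> Mf Mg; exact: latticeD Mf (latticeN Mg). Qed.

Lemma lattice_pos f : M f -> M (fun w => Num.max (f w) 0).
Proof. by move=> Mf; exact: lattice_max HM _ _ Mf (lattice_cst HM 0). Qed.

Lemma lattice_min f g : M f -> M g -> M (fun w => Num.min (f w) (g w)).
Proof.
move=> Mf Mg; move: (latticeN (lattice_max HM (latticeN Mf) (latticeN Mg))).
by congr M; apply/funext => w; rewrite oppr_max !opprK.
Qed.

Lemma lattice_sum (h : nat -> T -> R) n : (forall i, M (h i)) ->
  M (fun w => \sum_(i < n) h i w).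
Proof.
move=> Mh; elim: n => [|n IHn].
  move: (lattice_cst HM 0); congr M.
  by apply/funext => w; rewrite big_ord0.
move: (latticeD IHn (Mh n)); congr M.
by apply/funext => w; rewrite big_ord_recr.
Qed.

Lemma daniellD f g : M f -> M g -> I (fun w => f w + g w) = I f + I g.
Proof.
move=> Mf Mg; rewrite -[I f]mul1r -(daniell_lin HI)//; congr I.
by apply/funext => w; rewrite mul1r.
Qed.

Lemma daniellZ a f : M f -> I (fun w => a * f w) = a * I f.
Proof.
move=> Mf; have := daniell_lin HI a Mf (lattice_cst HM 0).
rewrite (daniell_cst HI) addr0 => <-; congr I.
by apply/funext => w; rewrite addr0.
Qed.

Lemma daniellN f : M f -> I (fun w => - f w) = - I f.
Proof.
move=> Mf; rewrite -mulN1r -daniellZ//; congr I.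
by apply/funext => w; rewrite mulN1r.
Qed.

Lemma daniell_sum (h : nat -> T -> R) n : (forall i, M (h i)) ->
  I (fun w => \sum_(i < n) h i w) = \sum_(i < n) I (h i).
Proof.
move=> Mh; elim: n => [|n IHn].
  rewrite big_ord0 -[RHS](daniell_cst HI); congr I.
  by apply/funext => w; rewrite big_ord0.
rewrite big_ord_recr/= -IHn -daniellD//; last exact: lattice_sum.
by congr I; apply/funext => w; rewrite big_ord_recr.
Qed.

(* [upper X c] says that the upper integral of [X] is at most [c]: it is the
   infimum of [lim I (h n)] over the increasing sequences whose limit, possibly
   infinite, dominates [X]. *)
Definition upper_approx (X : T -> R) (h : nat -> T -> R) : Prop :=
  [/\ forall n, M (h n), forall w, nondecreasing_seq (h^~ w) &
      forall w e, 0 < e -> exists n, X w - e <= h n w].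

Definition upper (X : T -> R) (c : R) : Prop :=
  exists2 h, upper_approx X h & forall n, I (h n) <= c.

(** Since [X >= 0], the negative parts [k m] of [h m] decrease to [0], so [I (k m)] vanishes in the
    limit and replacing [h] by its positive part costs nothing. This is where continuity of [I]
    enters the construction of the integral. *)
Lemma upper_approx_pos X h c : upper_approx X h -> (forall n, I (h n) <= c) ->
  (forall w, 0 <= X w) -> forall n, I (fun w => Num.max (h n w) 0) <= c.
Proof.
move=> [Mh h_nd Xh] hc X0 n; apply/ler_addgt0Pr => e e0.
pose k m w := Num.max (- h m w) 0.
have Mk m : M (k m) by exact/lattice_pos/latticeN.
have [|w m m' mm'|w e' e'0|m km] := daniell_continuous HI Mk _ _ _ e0.
- by move=> m w; rewrite le_max lexx orbT.
- have := h_nd w _ _ mm'; rewrite /k ge_max !le_max lexx orbT andbT lerN2.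
  by move=> ->.
- have [m Hm] := Xh w e' e'0; exists m.
  rewrite /k ge_max (ltW e'0) andbT; have := X0 w; intro_lra.
set p := maxn n m.
have pn : I (fun w => Num.max (h n w) 0) <= I (fun w => Num.max (h p w) 0).
  apply: (daniell_le HI) => [||w]; [exact: lattice_pos|exact: lattice_pos|].
  have := h_nd w _ _ (leq_maxl n m); rewrite ge_max !le_max lexx orbT andbT.
  by move=> ->.
apply: (le_trans pn).
have -> : I (fun w => Num.max (h p w) 0) = I (h p) + I (k p).
  rewrite -daniellD//; congr I; apply/funext => w; rewrite /k.
  have [?|?] := leP (h p w) 0; have [?|?] := leP (- h p w) 0; intro_lra.
apply: lerD => //; apply: le_trans km.
apply: (daniell_le HI) => // w.
have := h_nd w _ _ (leq_maxr n m); rewrite /k ge_max !le_max lexx orbT andbT.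
by rewrite lerN2 => ->.
Qed.

Lemma upper_le X Y c d : upper X c -> (forall w, Y w <= X w) -> c <= d ->
  upper Y d.
Proof.
move=> [h [Mh h_nd Xh] hc] YX cd; exists h => [|n].
  split=> // w e e0; have [n Hn] := Xh w e e0; exists n.
  by have := YX w; intro_lra.
exact: le_trans (hc n) cd.
Qed.

Lemma upper_nonneg X c : upper X c -> (forall w, 0 <= X w) ->
  exists h, [/\ upper_approx X h, forall n, I (h n) <= c &
                forall n w, 0 <= h n w].
Proof.
move=> [h Hh hc] X0; have [Mh h_nd Xh] := Hh.
exists (fun n w => Num.max (h n w) 0); split.
- split=> [n|w m n mn|w e e0]; first exact: lattice_pos.
    have := h_nd w _ _ mn; rewrite ge_max !le_max lexx orbT andbT.
    by move=> ->.
  by have [n Hn] := Xh w e e0; exists n; rewrite le_max Hn.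
- exact: upper_approx_pos Hh hc X0.
- by move=> n w; rewrite le_max lexx orbT.
Qed.

Lemma upper_ge0 X c : upper X c -> (forall w, 0 <= X w) -> 0 <= c.
Proof.
move=> Xc X0; have [h [[Mh _ _] hc h0]] := upper_nonneg Xc X0.
apply: le_trans (hc 0%N); rewrite -(daniell_cst HI 0).
by apply: (daniell_le HI) => //; exact: lattice_cst.
Qed.

Lemma upperD X Y c d : upper X c -> upper Y d ->
  upper (fun w => X w + Y w) (c + d).
Proof.
move=> [h [Mh h_nd Xh] hc] [k [Mk k_nd Yk] kd].
exists (fun n w => h n w + k n w) => [|n]; last first.
  by rewrite daniellD//; exact: lerD.
split=> [n|w m n mn|w e e0]; first exact: latticeD.
  by apply: lerD; [exact: h_nd|exact: k_nd].
have e20 : 0 < e / 2 by rewrite divr_gt0.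
have [m Hm] := Xh w _ e20; have [n Hn] := Yk w _ e20; exists (maxn m n).
have := h_nd w _ _ (leq_maxl m n); have := k_nd w _ _ (leq_maxr m n).
by intro_lra.
Qed.

Lemma upperZ a X c : 0 <= a -> upper X c -> upper (fun w => a * X w) (a * c).
Proof.
move=> a0 [h [Mh h_nd Xh] hc].
exists (fun n w => a * h n w) => [|n]; last first.
  by rewrite daniellZ//; exact: ler_wpM2l.
split=> [n|w m n mn|w e e0]; first exact: latticeZ.
  by apply: ler_wpM2l => //; exact: h_nd.
have ea0 : 0 < e / (a + 1) by rewrite divr_gt0//; intro_lra.
have [n Hn] := Xh w _ ea0; exists n.
apply: le_trans (ler_wpM2l a0 Hn); rewrite mulrBr lerD2l lerN2 mulrA.
rewrite ler_pdivrMr; last by intro_lra.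
by rewrite mulrC ler_pM2l//; intro_lra.
Qed.

Lemma upper_lattice f : M f -> upper f (I f).
Proof.
move=> Mf; exists (fun=> f) => //; split=> [//|w n m _ //|w e e0].
by exists 0%N; rewrite gerBl ltW.
Qed.

(** Countable subadditivity of the upper integral. The diagonal sums of [h i n] over [i < n]
    increase because the approximations can be taken nonnegative. *)
Lemma upper_sum (Y : nat -> T -> R) (c : nat -> R) X d :
  (forall i, upper (Y i) (c i)) -> (forall i w, 0 <= Y i w) ->
  (forall w e, 0 < e -> exists n, X w - e <= \sum_(i < n) Y i w) ->
  (forall n, \sum_(i < n) c i <= d) -> upper X d.
Proof.
move=> Yc Y0 XY cd.
have /choice[h Hh] : forall i, exists h, [/\ upper_approx (Y i) h,
    forall n, I (h n) <= c i & forall n w, 0 <= h n w].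
  by move=> i; exact: upper_nonneg.
have Mh i n : M (h i n) by have [[]] := Hh i.
have h_nd i w : nondecreasing_seq (h i ^~ w) by have [[]] := Hh i.
have h0 i n w : 0 <= h i n w by have [] := Hh i.
exists (fun n w => \sum_(i < n) h i n w) => [|n]; last first.
  rewrite (@daniell_sum (h^~ n))//; apply: le_trans (cd n).
  by apply: ler_sum => i _; have [_ hc _] := Hh i; exact: hc.
split=> [n|w m n mn|w e e0].
- exact: (@lattice_sum (h^~ n)).
- apply: (@le_trans _ _ (\sum_(i < m) h i n w)).
    by apply: ler_sum => i _; exact: h_nd.
  exact: (@ler_sum_ord _ (fun i => h i n w)).
have e20 : 0 < e / 2 by rewrite divr_gt0.
have [n Hn] := XY w _ e20.
suff [m Hm] : exists m, forall p, (m <= p)%N ->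
    \sum_(i < n) Y i w - e / 2 <= \sum_(i < n) h i p w.
  exists (maxn m n).
  have := Hm _ (leq_maxl m n).
  set S := \sum_(i < maxn m n) _.
  suff : \sum_(i < n) h i (maxn m n) w <= S by intro_lra.
  apply: (@ler_sum_ord _ (fun i => h i (maxn m n) w)) => //.
  exact: leq_maxr.
elim: n (e / 2) e20 {Hn} => [|n IHn] e' e'0.
  by exists 0%N => p _; rewrite !big_ord0; intro_lra.
have e20 : 0 < e' / 2 by rewrite divr_gt0.
have [m Hm] := IHn _ e20.
have [[_ _ /(_ w _ e20)[k Hk]] _ _] := Hh n.
exists (maxn m k) => p; rewrite geq_max => /andP[mp kp].
rewrite !big_ord_recr/=; have := Hm _ mp; have := h_nd n w _ _ kp.
by intro_lra.
Qed.

(** Upper and lower integral agree: the lower integral of [X] is minus the upper integral of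
    [- X]. *)
Definition has_integral (X : T -> R) (v : R) : Prop :=
  forall e, 0 < e -> upper X (v + e) /\ upper (fun w => - X w) (- v + e).

Lemma has_integral_le X Y u v : has_integral X u -> has_integral Y v ->
  (forall w, X w <= Y w) -> u <= v.
Proof.
move=> Xu Yv XY; apply/ler_addgt0Pr => e e0.
have e20 : 0 < e / 2 by rewrite divr_gt0.
suff : 0 <= v + e / 2 + (- u + e / 2) by intro_lra.
apply: upper_ge0 (upperD (Yv _ e20).1 (Xu _ e20).2) _ => w.
by rewrite subr_ge0.
Qed.

Lemma has_integral_unique X u v : has_integral X u -> has_integral X v -> u = v.
Proof.
by move=> Xu Xv; apply/le_anti/andP; split;
  [exact: has_integral_le Xu Xv _|exact: has_integral_le Xv Xu _].
Qed.

Lemma has_integral_lattice f : M f -> has_integral f (I f).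
Proof.
move=> Mf e e0; split; first by apply: upper_le (upper_lattice Mf) _ _; intro_lra.
apply: upper_le (upper_lattice (latticeN Mf)) _ _ => //.
by rewrite daniellN//; intro_lra.
Qed.

Lemma has_integralD X Y u v : has_integral X u -> has_integral Y v ->
  has_integral (fun w => X w + Y w) (u + v).
Proof.
move=> Xu Yv e e0; have e20 : 0 < e / 2 by rewrite divr_gt0.
have [Xu1 Xu2] := Xu _ e20; have [Yv1 Yv2] := Yv _ e20; split.
  by apply: upper_le (upperD Xu1 Yv1) _ _ => //; intro_lra.
by apply: upper_le (upperD Xu2 Yv2) _ _ => [w|]; intro_lra.
Qed.

Lemma has_integralN X u : has_integral X u -> has_integral (fun w => - X w) (- u).
Proof.
move=> Xu e e0; have [Xu1 Xu2] := Xu _ e0; split=> //.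
by apply: upper_le Xu1 _ _ => [w|]; intro_lra.
Qed.

Lemma has_integralZ a X u : has_integral X u ->
  has_integral (fun w => a * X w) (a * u).
Proof.
move=> Xu; wlog a0 : a X u Xu / 0 <= a => [H|].
  have [a0|a0] := leP 0 a; first exact: H.
  have := H (- a) _ _ (has_integralN Xu); rewrite oppr_ge0 (ltW a0) mulrNN.
  move=> /(_ isT); congr has_integral; apply/funext => w.
  by rewrite mulrNN.
move=> e e0; have ea0 : 0 < e / (a + 1) by rewrite divr_gt0//; intro_lra.
have ae : a * (e / (a + 1)) <= e.
  by rewrite mulrA ler_pdivrMr; nra.
have [Xu1 Xu2] := Xu _ ea0; split.
  by apply: upper_le (upperZ a0 Xu1) _ _ => //; rewrite mulrDr lerD2l.
by apply: upper_le (upperZ a0 Xu2) _ _ => [w|]; rewrite ?mulrDr mulrN// lerD2l.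
Qed.

(** The value is the infimum of the upper bounds [c]. It is finite because [upper_ge0] at
    [X - X = 0] gives [0 <= c + d] for all admissible [c] and [d]. *)
Lemma has_integral_ex X :
  (forall e, 0 < e -> exists c d, [/\ upper X c, upper (fun w => - X w) d &
     c + d <= e]) ->
  exists v, has_integral X v.
Proof.
move=> HX; pose A := [set c | upper X c].
have [c0 [d0 [c0X d0X _]]] := HX 1 ltr01.
have cd c d : upper X c -> upper (fun w => - X w) d -> 0 <= c + d.
  by move=> cX dX; apply: upper_ge0 (upperD cX dX) _ => w; rewrite subrr.
have lbA : has_lbound A.
  by exists (- d0) => c cX; have := cd _ _ cX d0X; intro_lra.
exists (inf A) => e e0.
have Ainf : has_inf A by split=> //; exists c0.
have [c Ac /ltW cA] := inf_adherent e0 Ainf.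
split; first exact: upper_le Ac _ _.
have [c' [d' [c'X d'X cd']]] := HX e e0.
have := ge_inf lbA c'X; move=> Ac'.
by apply: upper_le d'X _ _ => //; intro_lra.
Qed.

Lemma has_integral_uniform X :
  (forall e, 0 < e -> exists Y v, has_integral Y v /\ forall w, `|X w - Y w| <= e) ->
  exists v, has_integral X v.
Proof.
move=> HX; apply: has_integral_ex => e e0.
have e40 : 0 < e / 4 by rewrite divr_gt0.
have [Y [v [Yv XY]]] := HX _ e40.
have Me : M (cst (e / 4)) := lattice_cst HM _.
have [Yv1 Yv2] := Yv _ e40.
have Ue := upper_lattice Me; rewrite (daniell_cst HI) in Ue.
exists (v + e / 4 + e / 4), (- v + e / 4 + e / 4); split; last by intro_lra.
  apply: upper_le (upperD Yv1 Ue) _ _ => // w.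
  by have := XY w; rewrite ler_norml => /andP[? ?] /=; intro_lra.
apply: upper_le (upperD Yv2 Ue) _ _ => // w.
by have := XY w; rewrite ler_norml => /andP[? ?] /=; intro_lra.
Qed.

(** If [h] approximates [X] and [k] approximates [- X], then the positive part of [h] and
    [min (k, 0)] do so for the positive part of [X] and its opposite; what must be controlled is the
    sum of their integrals. *)
Lemma has_integral_pos X v : has_integral X v ->
  exists u, has_integral (fun w => Num.max (X w) 0) u.
Proof.
move=> Xv; apply: has_integral_ex => e e0.
have e20 : 0 < e / 2 by rewrite divr_gt0.
have [[h Hh hc] [k Hk kd]] := Xv _ e20.
have [Mh h_nd Xh] := Hh; have [Mk k_nd Xk] := Hk.
pose hp n w := Num.max (h n w) 0; pose km n w := Num.min (k n w) 0.
have Mhp n : M (hp n) by exact: lattice_pos.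
have Mkm n : M (km n) by exact: lattice_min (lattice_cst HM 0).
have hp_nd w : nondecreasing_seq (hp^~ w).
  by move=> m n /(h_nd w) mn; rewrite /hp ge_max !le_max lexx orbT andbT mn.
have km_nd w : nondecreasing_seq (km^~ w).
  by move=> m n /(k_nd w) mn; rewrite /km le_min !ge_min lexx orbT andbT mn.
have hk_approx : upper_approx (cst 0) (fun n w => h n w + k n w).
  split=> [n|w m n mn|w e' e'0]; first exact: latticeD.
    by apply: lerD; [exact: h_nd|exact: k_nd].
  have e20' : 0 < e' / 2 by rewrite divr_gt0.
  have [m Hm] := Xh w _ e20'; have [n Hn] := Xk w _ e20'.
  have := h_nd w _ _ (leq_maxl m n); have := k_nd w _ _ (leq_maxr m n).
  by exists (maxn m n); rewrite /cst; intro_lra.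
have hk_le n : I (fun w => h n w + k n w) <= e.
  by rewrite daniellD//; have := hc n; have := kd n; intro_lra.
(* [h^+ + min(k, 0) = h^+ - (-k)^+ <= (h + k)^+] *)
have hpkm n : I (hp n) + I (km n) <= e.
  rewrite -daniellD//.
  apply: le_trans (upper_approx_pos hk_approx hk_le (fun w => lexx 0) n).
  apply: (daniell_le HI) => [||w]; [exact: latticeD|exact/lattice_pos/latticeD|].
  rewrite /hp /km; have [?|?] := leP (h n w) 0; have [?|?] := leP (k n w) 0;
    have [?|?] := leP (h n w + k n w) 0; intro_lra.
(* Monotonicity decouples the two indices, so that the supremum over [m] can be taken with [n]
   fixed; this supremum and its complement to [e] are the two bounds. *)
have hpkm2 m n : I (hp m) + I (km n) <= e.
  apply: le_trans (hpkm (maxn m n)); apply: lerD; apply: (daniell_le HI) => // w.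
    exact: (hp_nd w _ _ (leq_maxl m n)).
  exact: (km_nd w _ _ (leq_maxr m n)).
have hp_ub : has_ubound (range (fun n => I (hp n))).
  by exists (e - I (km 0%N)) => _ [n _ <-]; have := hpkm2 n 0%N; intro_lra.
have km_le n : I (km n) <= e - sup (range (fun n => I (hp n))).
  suff : sup (range (fun n => I (hp n))) <= e - I (km n) by intro_lra.
  apply: ge_sup; first by exists (I (hp 0%N)), 0%N.
  by move=> _ [m _ <-]; have := hpkm2 m n; intro_lra.
exists (sup (range (fun n => I (hp n)))), (e - sup (range (fun n => I (hp n)))).
split; last by intro_lra.
- exists hp => [|n]; last by apply: ub_le_sup => //; exists n.
  split=> // w e' e'0; have [n Hn] := Xh w e' e'0; exists n.
  have [X0|X0] := leP (X w) 0; rewrite /hp le_max; apply/orP; [right|left] => //.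
  by intro_lra.
- exists km => //; split=> // w e' e'0; have [n Hn] := Xk w e' e'0; exists n.
  have [X0|X0] := leP (X w) 0; rewrite /km le_min; apply/andP; split; intro_lra.
Qed.

Lemma has_integral_max X Y u v : has_integral X u -> has_integral Y v ->
  exists c, has_integral (fun w => Num.max (X w) (Y w)) c.
Proof.
move=> Xu Yv; have [c Hc] := has_integral_pos (has_integralD Xu (has_integralN Yv)).
exists (c + v); move: (has_integralD Hc Yv); congr has_integral.
apply/funext => w; have [?|?] := leP (X w - Y w) 0;
  have [?|?] := leP (X w) (Y w); intro_lra.
Qed.

(** Monotone convergence. The difference [X - X_ 0] is the series of the nonnegative increments of
    [X_], to which [upper_sum] applies; for [- X] it suffices to compare with a single [- X_ n]. *)
Lemma has_integral_increasing (X_ : nat -> T -> R) (v_ : nat -> R) X :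
  (forall n, has_integral (X_ n) (v_ n)) ->
  (forall w, increases_to (X_^~ w) (X w)) -> has_ubound (range v_) ->
  has_integral X (sup (range v_)) /\ increases_to v_ (sup (range v_)).
Proof.
move=> Xv XX ubv; set v := sup (range v_).
have X_nd n w : X_ n w <= X_ n.+1 w.
  by have /increases_toP[/nondecreasing_seqP H _ _] := XX w; exact: H.
have v_nd : nondecreasing_seq v_.
  by apply/nondecreasing_seqP => n; exact: has_integral_le (Xv n) (Xv n.+1) _.
have v_le n : v_ n <= v by apply: ub_le_sup => //; exists n.
have v_app e : 0 < e -> exists n, v - e <= v_ n.
  move=> e0; have : has_sup (range v_) by split=> //; exists (v_ 0%N), 0%N.
  by move=> /(sup_adherent e0)[_ [n _ <-] /ltW]; exists n.
split; last exact/increases_toP.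
move=> e e0; have e20 : 0 < e / 2 by rewrite divr_gt0.
split; last first.
  have [n Hn] := v_app _ e20; apply: upper_le (Xv n _ e20).2 _ _ => [w|].
    by have /increases_toP[_ H _] := XX w; rewrite lerN2.
  by intro_lra.
(* The values telescope and the errors add up to at most [e / 2]. *)
pose d i := v_ i.+1 - v_ i + e / 2 / 2 ^+ i.+1.
have dsum n : \sum_(i < n) d i = v_ n - v_ 0%N + e / 2 * (1 - (2 ^+ n)^-1).
  elim: n => [|n IHn]; first by rewrite big_ord0 expr0 invr1 !subrr mulr0 addr0.
  rewrite big_ord_recr/= IHn /d exprS; field.
  by rewrite expf_neq0.
have Ysum n w : \sum_(i < n) (X_ i.+1 w - X_ i w) = X_ n w - X_ 0%N w.
  elim: n => [|n IHn]; first by rewrite big_ord0 subrr.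
  by rewrite big_ord_recr/= IHn; ring.
have Ud : upper (fun w => X w - X_ 0%N w) (v - v_ 0%N + e / 2).
  apply: (@upper_sum (fun i w => X_ i.+1 w - X_ i w) d) => [i|i w|w e' e'0|n].
  - have := has_integralD (Xv i.+1) (has_integralN (Xv i)).
    by move=> /(_ (e / 2 / 2 ^+ i.+1)); case=> //; rewrite divr_gt0// exprn_gt0.
  - by rewrite subr_ge0.
  - have /increases_toP[_ _ /(_ _ e'0)[n Hn]] := XX w; exists n.
    by rewrite Ysum; intro_lra.
  - rewrite dsum; apply: lerD; first by rewrite lerD2r.
    by rewrite ler_piMr ?ltW// gerBl ltW// invr_gt0 exprn_gt0.
apply: upper_le (upperD Ud (Xv 0%N _ e20).1) _ _ => [w|]; intro_lra.
Qed.

End daniell.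

(** * Extension to bounded measurable functions *)

Section linear_expectations.
Variables (R : realType) (d : measure_display) (T : measurableType d).

Record linear_expectation (J : (T -> R) -> R) : Prop := {
  linear_expectation_lin : forall a X Y, Linfty X -> Linfty Y ->
    J (fun w => a * X w + Y w) = a * J X + J Y ;
  linear_expectation_space : convex_expectation_space J
}.

Lemma LinftyP (X : T -> R) :
  Linfty X <-> measurable_fun setT X /\ exists C, forall w, `|X w| <= C.
Proof. by split=> -[mX /bounded_fun_leP bX]. Qed.

Lemma Linfty_lin (a : R) (X Y : T -> R) : Linfty X -> Linfty Y ->
  Linfty (fun w => a * X w + Y w).
Proof.
move=> /LinftyP[mX [C XC]] /LinftyP[mY [D YD]]; apply/LinftyP; split.
  by apply: measurable_funD => //; exact: measurable_funM.
exists (`|a| * C + D) => w; apply: (le_trans (ler_normD _ _)); rewrite normrM.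
by apply: lerD => //; exact: ler_wpM2l.
Qed.

Lemma Linfty_cst (c : R) : Linfty (cst c : T -> R).
Proof. by apply/LinftyP; split; [exact: measurable_cst|exists `|c|]. Qed.

Lemma Linfty_affine (a b : R) (X : T -> R) : Linfty X ->
  Linfty (fun w => a * X w + b).
Proof. by move=> LX; exact: Linfty_lin LX (Linfty_cst b). Qed.

Lemma Linfty_lim (X_ : nat -> T -> R) (X : T -> R) C :
  (forall n, Linfty (X_ n)) -> (forall w, `|X w| <= C) ->
  (forall w, increases_to (X_^~ w) (X w)) -> Linfty X.
Proof.
move=> LX XC XX; apply/LinftyP; split; last by exists C.
apply: (measurable_fun_cvg (h := X_)) => [n|w _].
  by have /LinftyP[] := LX n.
by have [_] := XX w.
Qed.

End linear_expectations.

Section daniell_extension.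
Variables (R : realType) (T : pointedType) (M : set (T -> R)).
Variable I : (T -> R) -> R.
Hypotheses (HM : function_lattice M) (HI : daniell_functional M I).

(* Generating the sigma-algebra by all of [M], not by the coordinates, makes [M]
   measurable without comparing Borel sets of products with products. *)
Definition positivity_sets : set (set T) := [set [set w | 0 < h w] | h in M].

Local Notation TM := (g_sigma_algebraType positivity_sets).

Lemma lattice_Linfty f : M f -> Linfty (f : TM -> R).
Proof.
move=> Mf; apply/LinftyP; split; last exact: lattice_bounded HM _ Mf.
apply: (measurability (@RGenOInfty.G R)); first exact: RGenOInfty.measurableE.
move=> _ [_ [x ->] <-]; rewrite setTI; apply: sub_sigma_algebra.
exists (fun w => f w + - x); first exact: latticeD Mf (lattice_cst HM _).
by apply/seteqP; split => w /=; rewrite in_itv/= andbT subr_gt0.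
Qed.

Let integrable (X : T -> R) := exists v, has_integral M I X v.

Let integrable_lin a X Y : integrable X -> integrable Y ->
  integrable (fun w => a * X w + Y w).
Proof.
move=> [u Xu] [v Yv]; exists (a * u + v).
exact: has_integralD HM HI _ _ _ _ (has_integralZ HM HI a Xu) Yv.
Qed.

Let integrable_cst c : integrable (cst c).
Proof. by exists (I (cst c)); apply: has_integral_lattice HM HI _ (lattice_cst HM _). Qed.

Let integrable_increasing (X_ : nat -> T -> R) X C :
  (forall n, integrable (X_ n)) ->
  (forall w, increases_to (X_^~ w) (X w)) -> (forall w, X w <= C) -> integrable X.
Proof.
move=> /choice[v_ Xv] XX XC; exists (sup (range v_)).
apply: (has_integral_increasing HM HI Xv XX _).1.
exists C => _ [n _ <-]; rewrite -(daniell_cst HI C).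
apply: has_integral_le HM HI _ _ _ _ (Xv n)
  (has_integral_lattice HM HI (lattice_cst HM C)) _ => w.
by have /increases_toP[_ H _] := XX w; exact: le_trans (H n) (XC w).
Qed.

Let integrable_max X Y : integrable X -> integrable Y ->
  integrable (fun w => Num.max (X w) (Y w)).
Proof. by move=> [u Xu] [v Yv]; exact: has_integral_max HM HI _ _ _ _ Xu Yv. Qed.

Let indic_bigcup_increases (A : nat -> set T) w :
  increases_to (fun n => \1_(\big[setU/set0]_(i < n) A i) w : R)
    (\1_(\bigcup_i A i) w).
Proof.
have in01 (B : set T) : 0 <= (\1_B w : R) <= 1.
  by rewrite indicE; case: (w \in B); rewrite /= ?lexx ?ler01.
apply/increases_toP; split=> [m n mn|n|e e0].
- rewrite !indicE ler_nat; case: (boolP (w \in _)) => // /set_mem wA.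
  by rewrite mem_set//; exact: (@subset_bigsetU _ A _ _ mn _ wA).
- rewrite !indicE ler_nat; case: (boolP (w \in _)) => // /set_mem wA.
  by rewrite mem_set//; exact: (@bigsetU_bigcup _ A n _ wA).
have [[i _ Aiw]|nA] := pselect ((\bigcup_i A i) w).
  exists i.+1; rewrite !indicE mem_set; last by exists i.
  rewrite mem_set ?gerBl ?ltW// big_ord_recr /=; by right.
exists 0%N; rewrite !indicE memNset//= sub0r.
by apply: le_trans (ler0n _ _); rewrite oppr_le0 ltW.
Qed.

(** The sets with integrable indicator form a sigma-algebra, finite unions being maxima and
    countable ones increasing limits. For a generator, the indicator of [0 < h] is the increasing
    limit of [min (n * max (h, 0), 1)]. *)
Let integrable_indic (B : set TM) : measurable B -> integrable (\1_B).
Proof.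
apply: (@smallest_sub _ _ _ [set A | integrable (\1_A)]) => [|_ [h Mh <-]] /=.
- split.
  + by rewrite /= indic0; exact: integrable_cst.
  + move=> A /= IA; have := integrable_lin (-1) IA (integrable_cst 1).
    congr integrable; apply/funext => w; rewrite setTD !indicE in_setC /=.
    by case: (w \in A); rewrite /= ; intro_lra.
  + move=> A IA; apply: integrable_increasing (indic_bigcup_increases A) _.
      elim=> [|n IHn]; first by rewrite big_ord0 indic0; exact: integrable_cst.
      rewrite big_ord_recr /=.
      have := integrable_max IHn (IA n); congr integrable.
      apply/funext => w; rewrite !indicE in_setU.
      case: (w \in _); case: (w \in _) => /=; rewrite ?maxxx//.
        by rewrite max_l.
      by rewrite max_r.
    by move=> w; rewrite indicE; case: (w \in _); rewrite /= ?lexx ?ler01.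
pose g n w := Num.min (n%:R * Num.max (h w) 0) 1.
have Mg n : M (g n).
  apply: (lattice_min HM) (lattice_cst HM 1).
  exact/(latticeZ HM)/(lattice_pos HM).
apply: (@integrable_increasing g _ 1) => [n|w|w].
- by exists (I (g n)); exact: has_integral_lattice.
- apply/increases_toP; split=> [|n|e e0].
  + move=> m n mn; rewrite /g le_min !ge_min lexx orbT andbT.
    by rewrite ler_wpM2r ?ler_nat// le_max lexx orbT.
  + rewrite /g indicE; have [hw|hw] := ltP 0 (h w).
      by rewrite mem_set//= ge_min lexx orbT.
    rewrite memNset; last by rewrite /= ltNge hw.
    by rewrite mulr0 (min_l ler01).
  + rewrite indicE; have [hw|hw] := ltP 0 (h w); last first.
      rewrite memNset; last by rewrite /= ltNge hw.
      by exists 0%N; rewrite /g mul0r (min_l ler01)/=; intro_lra.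
    rewrite mem_set//; exists (Num.bound `|(h w)^-1|); rewrite /g.
    have : (h w)^-1 <= (Num.bound `|(h w)^-1|)%:R.
      by rewrite (le_trans (ler_norm _))// ltW// archi_boundP.
    rewrite -[leLHS]div1r ler_pdivrMr// => H.
    by rewrite (max_l (ltW hw)) (min_r H) gerBl ltW.
- by rewrite indicE; case: (w \in _); rewrite /= ?lexx ?ler01.
Qed.

(* Bisection: [c (2 1_{X >= 0} - 1)] approximates [X] within [c] whenever
   [|X| <= 2 c]. *)
Lemma Linfty_has_integral (X : TM -> R) : Linfty X ->
  exists v, has_integral M I X v.
Proof.
move=> LX; have /LinftyP[_ [C0 XC0]] := LX; pose C := `|C0|.
have XC w : `|X w| <= C by rewrite (le_trans (XC0 w))// ler_norm.
suff H n : exists Y : TM -> R, [/\ Linfty Y, integrable Y &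
    forall w, `|X w - Y w| <= C / 2 ^+ n].
  apply: (@has_integral_uniform R T M I HM HI X) => e e0.
  have [n Cn] : exists n, C / 2 ^+ n <= e.
    exists (Num.bound `|C / e|); rewrite ler_pdivrMr ?exprn_gt0//.
    rewrite mulrC -ler_pdivrMr// (le_trans (ler_norm _))// ltW//.
    apply: (lt_trans (archi_boundP (normr_ge0 _))).
    by rewrite -natrX ltr_nat ltn_expl.
  have [Y [_ [v Yv] XY]] := H n; exists Y, v; split=> // w.
  exact: le_trans (XY w) Cn.
elim: n => [|n [Y [LY IY XY]]].
  exists (cst 0); split=> [||w]; [exact: Linfty_cst|exact: integrable_cst|].
  by rewrite subr0 expr0 divr1.
pose c := C / 2 ^+ n.+1; have cE : C / 2 ^+ n = 2 * c.
  by rewrite /c exprS; field; rewrite expf_neq0.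
have LD : Linfty (fun w => X w - Y w).
  move: (Linfty_lin (-1) LY LX); congr Linfty.
  by apply/funext => w; rewrite mulN1r addrC.
pose A : set TM := (fun w => X w - Y w) @^-1` `[0, +oo[%classic.
have mA : measurable A.
  have /LinftyP[mD _] := LD; rewrite -[A]setTI.
  exact: (mD measurableT _ (measurable_itv _)).
have LA : Linfty (\1_A : TM -> R).
  apply/LinftyP; split; first exact: measurable_indic.
  by exists 1 => w; rewrite indicE; case: (w \in A); rewrite /= ?normr1 ?normr0.
exists (fun w => 1 * Y w + (2 * c * \1_A w + - c)); split.
- exact: (Linfty_lin 1 LY (Linfty_lin (2 * c) LA (Linfty_cst _ (- c)))).
- exact: (integrable_lin 1 IY (integrable_lin (2 * c) (integrable_indic mA) (integrable_cst (- c)))).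
move=> w; rewrite -/c; have := XY w; rewrite cE !ler_norml => /andP[? ?].
rewrite indicE; have [D0|D0] := leP 0 (X w - Y w).
  rewrite mem_set; last by rewrite /A/= in_itv/= andbT.
  by apply/andP; split => /=; intro_lra.
rewrite memNset; last by rewrite /A/= in_itv/= andbT; apply/negP; rewrite -ltNge.
by apply/andP; split => /=; intro_lra.
Qed.

Lemma daniell_extension : exists J : (TM -> R) -> R,
  linear_expectation J /\ forall f, M f -> J f = I f.
Proof.
pose J (X : TM -> R) := xget 0 [set v | has_integral M I X v].
have JP (X : TM -> R) : Linfty X -> has_integral M I X (J X).
  by move=> /Linfty_has_integral[v Xv]; rewrite /J; case: xgetP => // /(_ v).
have JE (X : TM -> R) v : Linfty X -> has_integral M I X v -> J X = v.
  by move=> LX Xv; apply: has_integral_unique HM HI _ _ _ (JP X LX) Xv.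
have Jlin a (X Y : TM -> R) : Linfty X -> Linfty Y ->
    J (fun w => a * X w + Y w) = a * J X + J Y.
  move=> LX LY; apply: JE; first exact: Linfty_lin.
  exact: has_integralD HM HI _ _ _ _ (has_integralZ HM HI a (JP _ LX)) (JP _ LY).
have JM f : M f -> J f = I f.
  by move=> Mf; apply: JE; [exact: lattice_Linfty|exact: has_integral_lattice].
have Jle (X Y : TM -> R) : Linfty X -> Linfty Y -> (forall w, X w <= Y w) -> J X <= J Y.
  by move=> LX LY XY; apply: has_integral_le HM HI _ _ _ _ (JP _ LX) (JP _ LY) XY.
exists J; split=> //; split=> //; split.
  split=> //.
    by move=> a; rewrite JM ?(daniell_cst HI)//; exact: lattice_cst.
  move=> X Y l LX LY _; rewrite (Jlin l X (fun w => (1 - l) * Y w))//; last first.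
    move: (Linfty_affine (1 - l) 0 LY); congr Linfty.
    by apply/funext => w; rewrite addr0.
  rewrite lerD2l; have := Jlin (1 - l) Y (cst 0) LY (Linfty_cst _ 0).
  rewrite [J (cst 0)]JM ?(daniell_cst HI) ?addr0; last exact: lattice_cst.
  move=> <-; rewrite (_ : (fun w => (1 - l) * Y w) = fun w => (1 - l) * Y w + cst 0 w)//.
  by apply/funext => w; rewrite addr0.
move=> X_ X LX_ LX XX.
have ub : has_ubound (range (fun n => J (X_ n))).
  exists (J X) => _ [n _ <-]; apply: Jle => // w.
  by have /increases_toP[] := XX w.
have [XJ] := has_integral_increasing HM HI (fun n => JP _ (LX_ n)) XX ub.
by rewrite (JE _ _ LX XJ).
Qed.

End daniell_extension.

(** * Iterated expectations on the path space *)

Section group_distance.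
Variables (R : realType) (G : invariantMetricGroup R).

Definition gdist (x y : G) : R := @group_dist R G x y.

Lemma gdistxx x : gdist x x = 0. Proof. exact: group_distxx. Qed.

Lemma gdistC x y : gdist x y = gdist y x. Proof. exact: group_dist_sym. Qed.

Lemma gdist_triangle y x z : gdist x z <= gdist x y + gdist y z.
Proof. exact: group_dist_triangle. Qed.

Lemma gdistDr (z x y : G) : gdist (x + z) (y + z) = gdist x y.
Proof. exact: group_dist_invariant. Qed.

Lemma gdistDl (z x y : G) : gdist (z + x) (z + y) = gdist x y.
Proof. by rewrite ![z + _]addrC gdistDr. Qed.

Lemma gdist_ge0 x y : 0 <= gdist x y.
Proof. by have := gdist_triangle y x x; rewrite gdistxx gdistC; intro_lra. Qed.

Lemma gdistB (x y x' y' : G) :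
  gdist (x - y) (x' - y') <= gdist x x' + gdist y y'.
Proof.
apply: (le_trans (gdist_triangle (x' - y) _ _)); rewrite gdistDr gdistDl lerD2l.
by rewrite -(gdistDr (y + y')) addrA addNr add0r [y + y']addrC addrA addNr add0r gdistC.
Qed.

Lemma gdist_ballE (x : G) e : ball x e = [set y | gdist x y < e].
Proof. by []. Qed.

Lemma BUC_P (f : G -> R) : BUC f <->
  (forall e, 0 < e -> exists2 d, 0 < d &
     forall x y, gdist x y < d -> `|f x - f y| <= e) /\
  exists C, forall x, `|f x| <= C.
Proof.
split=> -[fu fb]; split; try exact/bounded_fun_leP.
  move=> e e0; have /unif_continuousP/(_ e e0)[d d0 dP] := fu.
  by exists d => // x y xy; exact/ltW/(dP (x, y)).
apply/unif_continuousP => e e0; have e20 : 0 < e / 2 by rewrite divr_gt0.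
have [d d0 dP] := fu _ e20; exists d => // -[x y] /= xy.
apply: (le_lt_trans (dP x y xy)); intro_lra.
Qed.

Lemma BUC_affine (a b : R) (f : G -> R) : BUC f -> BUC (fun x => a * f x + b).
Proof.
move=> /BUC_P[fu [C fC]]; apply/BUC_P; split.
  move=> e e0; have ea0 : 0 < e / (`|a| + 1) by rewrite divr_gt0// ltr_wpDl.
  have [d d0 dP] := fu _ ea0; exists d => // x y xy.
  rewrite opprD addrACA subrr addr0 -mulrBr normrM.
  apply: (le_trans (ler_wpM2l (normr_ge0 a) (dP _ _ xy))).
  by rewrite mulrA ler_pdivrMr ?ltr_wpDl//; have := normr_ge0 a; intro_nra.
exists (`|a| * C + `|b|) => x; apply: (le_trans (ler_normD _ _)).
by rewrite normrM lerD2r; exact: ler_wpM2l.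
Qed.

Lemma BUC_cst (c : R) : BUC (cst c : G -> R).
Proof.
apply/BUC_P; split; last by exists `|c|.
by move=> e e0; exists 1 => // x y _; rewrite subrr normr0 ltW.
Qed.

Lemma BUC_translate (f : G -> R) (x : G) : BUC f -> BUC (fun y => f (x + y)).
Proof.
move=> /BUC_P[fu [C fC]]; apply/BUC_P; split; last by exists C.
move=> e /fu[d d0 dP]; exists d => // y z yz; apply: dP.
by rewrite gdistDl.
Qed.

End group_distance.

Section path_expectation.
Variables (R : realType) (G : invariantMetricGroup R).
Variable E : R -> (G -> R) -> R.
Hypothesis E_convex : forall t, 0 <= t -> convex_expectation (@BUC R _) (E t).
Hypothesis E_0 : forall f, BUC f -> E 0 f = f 0.
Hypothesis E_add : forall s t f, 0 <= s -> 0 <= t -> BUC f ->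
  E (s + t) f = E s (fun x => E t (fun y => f (x + y))).

Local Notation path_space := (R -> G).
Implicit Types (w : path_space) (h : path_space -> R) (J ts : seq R).

Definition jump w (t : R) (y : G) : path_space :=
  fun u => w u + (if t <= u then y else 0).

(** Continuity is uniform because [E t] is only known on [BUC]. Adding the same jump to two paths
    preserves their distances, so one modulus survives the iterated expectations. *)
Definition cylinder_on J h : Prop :=
  (forall e, 0 < e -> exists2 d, 0 < d & forall w w',
     (forall u, u \in J -> gdist (w u) (w' u) < d) -> `|h w - h w'| <= e) /\
  exists C, forall w, `|h w| <= C.

Lemma cylinder_on_eq J h w w' : cylinder_on J h ->
  (forall u, u \in J -> w u = w' u) -> h w = h w'.
Proof.
move=> [hu _] ww'; apply/eqP; rewrite -subr_eq0 -normr_le0; apply/ler_addgt0Pr => e e0.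
have [d d0 dP] := hu e e0; rewrite add0r; apply: dP => u /ww' ->.
by rewrite gdistxx.
Qed.

Lemma cylinder_on_sub J J' h : {subset J <= J'} -> cylinder_on J h ->
  cylinder_on J' h.
Proof.
move=> JJ' [hu hb]; split=> // e /hu[d d0 dP]; exists d => // w w' ww'.
by apply: dP => u /JJ'; exact: ww'.
Qed.

Lemma cylinder_on_jump_BUC J h w t : cylinder_on J h ->
  BUC (fun y => h (jump w t y)).
Proof.
move=> [hu [C hC]]; apply/BUC_P; split; last by exists C.
move=> e /hu[d d0 dP]; exists d => // x y xy; apply: dP => u _.
by rewrite /jump gdistDl; case: ifP => // _; rewrite gdistxx.
Qed.

Let dist_le t f g c : 0 <= t -> BUC f -> BUC g ->
  (forall x, `|f x - g x| <= c) -> `|E t f - E t g| <= c.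
Proof.
by move=> t0; apply: (expectation_dist_le (@BUC_affine R G) (E_convex t0)).
Qed.

Let norm_le t f c : 0 <= t -> BUC f -> (forall x, `|f x| <= c) -> `|E t f| <= c.
Proof.
move=> t0 Bf fc; have := dist_le t0 Bf (BUC_cst G 0).
rewrite (Defs.expectation_cst (E_convex t0)) subr0; apply => x.
by rewrite subr0.
Qed.

(** Conditional expectation given the path up to [s], with the whole increment over [[s, t]] placed
    as one jump at [t]. *)
Definition step s t h w : R := E (t - s) (fun y => h (jump w t y)).

Lemma cylinder_on_step J s t h : s <= t -> cylinder_on J h ->
  cylinder_on J (step s t h).
Proof.
move=> st Jh; have [hu [C hC]] := Jh; split.
  move=> e /hu[d d0 dP]; exists d => // w w' ww'.
  apply: dist_le; rewrite ?subr_ge0//; try exact: cylinder_on_jump_BUC Jh.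
  by move=> y; apply: dP => u uJ; rewrite /jump gdistDr; exact: ww'.
exists C => w; apply: norm_le; rewrite ?subr_ge0//.
exact: cylinder_on_jump_BUC Jh.
Qed.

(** Chapman-Kolmogorov: the jumps at [t] and [r] merge by [E_add], as no time of [J] in [[t, r)] can
    tell them apart. *)
Lemma step_insert J s t r h w : s <= t -> t <= r -> cylinder_on J h ->
  (forall u, u \in J -> t <= u -> r <= u) ->
  step s t (step t r h) w = step s r h w.
Proof.
move=> st tr Jh tJ; rewrite /step.
have -> : r - s = (t - s) + (r - t) by ring.
rewrite [RHS]E_add ?subr_ge0//; last first.
  exact: cylinder_on_jump_BUC Jh.
congr (E _ _); apply/funext => y; congr (E _ _); apply/funext => z.
apply: (cylinder_on_eq Jh) => u uJ; rewrite /jump -addrA; congr (_ + _).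
have [tu|ut] := leP t u; first by rewrite (tJ u).
by rewrite leNgt (lt_le_trans ut tr) addr0.
Qed.

Lemma step_end J s t h w : s <= t -> cylinder_on J h ->
  (forall u, u \in J -> u < t) -> step s t h w = h w.
Proof.
move=> st Jh Jt.
have st0 : 0 <= t - s by rewrite subr_ge0.
rewrite /step -[RHS](Defs.expectation_cst (E_convex st0)).
congr (E _ _); apply/funext => y; apply: (cylinder_on_eq Jh) => u uJ.
by rewrite /jump leNgt Jt// addr0.
Qed.

(* The expectation of [h] when [w] receives independent increments, jumping at the
   times [ts] only: cylinder functions at the times [ts] do not see the rest. *)
Fixpoint steps s ts h w : R :=
  if ts is t :: ts' then step s t (steps t ts' h) w else h w.

Lemma cylinder_on_steps J ts s h : path <=%R s ts -> cylinder_on J h ->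
  cylinder_on J (steps s ts h).
Proof.
elim: ts s => [//|t ts IHts] s /= /andP[st tts] Jh.
by apply: cylinder_on_step => //; exact: IHts.
Qed.

Lemma steps_rcons s ts t h w :
  steps s (rcons ts t) h w = steps s ts (step (last s ts) t h) w.
Proof.
elim: ts s w => [//|r ts IHts] s w /=.
by rewrite /step; congr (E _ _); apply/funext => y; rewrite IHts.
Qed.

(** A time outside [J] is merged into the next one by [step_insert], or is the last one and
    invisible to [h] by [step_end]. *)
Lemma steps_filter J ts s h w : path <=%R s ts -> cylinder_on J h ->
  (forall u, u \in J -> s < u -> u \in ts) ->
  steps s ts h w = steps s [seq u <- ts | u \in J] h w.
Proof.
elim: ts s w => [//|t ts IHts] s w /= /andP[st tts] Jh Jts.
have [tJ|tJ] := boolP (t \in J) => /=.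
  rewrite /step; congr (E _ _); apply/funext => y; apply: IHts => // u uJ tu.
  have := Jts u uJ (le_lt_trans st tu).
  by rewrite inE gt_eqF.
case: ts tts IHts Jts => [|r ts] /= => [_ _ Jts|/andP[tr rts] IHts Jts].
  apply: (step_end _ st Jh) => u uJ; rewrite ltNge; apply/negP => tu.
  have tu' : t < u by rewrite lt_def tu andbT; apply: contraNneq tJ => <-.
  by have := Jts u uJ (le_lt_trans st tu'); rewrite inE gt_eqF.
rewrite (@step_insert J)//; last 2 first.
- exact: cylinder_on_steps.
- move=> u uJ tu.
  have tu' : t < u by rewrite lt_def tu andbT; apply: contraNneq tJ => <-.
  have := Jts u uJ (le_lt_trans st tu'); rewrite !inE gt_eqF//=.
  case/predU1P => [->//|uts]; have := rts; rewrite le_path_sortedE.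
  by move=> /andP[/allP/(_ u uts)].
apply: (IHts s w) => //; first by rewrite /= (le_trans st tr).
move=> u uJ su; have := Jts u uJ su; rewrite inE => /predU1P[ut|//].
by rewrite ut in uJ; rewrite uJ in tJ.
Qed.

(** A repeated time contributes a jump of law [E 0], absorbed by [step_insert] with [r = t]. *)
Lemma steps_undup J ts s h w : path <=%R s ts -> cylinder_on J h ->
  steps s (undup ts) h w = steps s ts h w.
Proof.
elim: ts s w => [//|t ts IHts] s w /= /andP[st tts] Jh.
case: ifPn => [tts'|_]; last first.
  by rewrite /= /step; congr (E _ _); apply/funext => y; exact: IHts.
rewrite IHts//; last by case: (ts) tts => [//|r ts'] /= /andP[/(le_trans st)->].
case: ts tts tts' {IHts} => [//|r ts] /= /andP[tr rts].
rewrite inE => tts.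
have rt : r = t.
  apply/le_anti; rewrite tr andbT; case/predU1P: tts => [->//|tts].
  by have := rts; rewrite le_path_sortedE => /andP[/allP/(_ t tts)].
rewrite (@step_insert J)//; first by exact: cylinder_on_steps.
by rewrite rt.
Qed.

Lemma steps_irrelevant J J' h w : path <=%R 0 J -> path <=%R 0 J' ->
  cylinder_on J h -> cylinder_on J' h -> steps 0 J h w = steps 0 J' h w.
Proof.
(* Both lists are compared with their sorted union, which is symmetric in [J] and [J']. *)
wlog suff H : J J' / path <=%R 0 J -> path <=%R 0 J' ->
    cylinder_on J h -> steps 0 J h w = steps 0 (sort <=%R (J ++ J')) h w.
  move=> J0 J0' Jh Jh'; rewrite (H J J')// (H J' J)//; congr (steps _ _ _ _).
  by apply/perm_sort_leP; rewrite perm_catC.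
move=> J0 J0' Jh; set K := sort _ _.
have K0 : path <=%R 0 K.
  rewrite le_path_sortedE sort_le_sorted andbT; apply/allP => u.
  rewrite mem_sort mem_cat; move: J0 J0'; rewrite !le_path_sortedE.
  by move=> /andP[/allP J0 _] /andP[/allP J0' _] /orP[/J0|/J0'].
rewrite [RHS](@steps_filter J)// => [|u uJ _]; last first.
  by rewrite mem_sort mem_cat uJ.
have F0 : path <=%R 0 [seq u <- K | u \in J].
  by apply: (subseq_path le_trans (filter_subseq _ _)).
(* [J] and the filtered [K] have the same elements, but possibly with different multiplicities. *)
rewrite -(@steps_undup J J)// -(@steps_undup J [seq u <- K | _])//.
congr (steps _ _ _ _); apply: le_sorted_eq.
- by apply: (subseq_sorted le_trans (undup_subseq _)); exact: path_sorted J0.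
- by apply: (subseq_sorted le_trans (undup_subseq _)); exact: path_sorted F0.
- apply: uniq_perm; rewrite ?undup_uniq// => u.
  rewrite !mem_undup mem_filter mem_sort mem_cat.
  by case: (u \in J).
Qed.

Definition cylinder h : Prop := exists2 J, path <=%R 0 J & cylinder_on J h.

(** The choice of [J] is immaterial by [steps_irrelevant]; outside the cylinder functions the value
    is the default [0]. Starting from [cst 0] encodes that the process starts at [0]. *)
Definition path_expectation h : R :=
  xget 0 [set v | exists J, [/\ path <=%R 0 J, cylinder_on J h &
                              v = steps 0 J h (cst 0)]].

Lemma path_expectationE J h : path <=%R 0 J -> cylinder_on J h ->
  path_expectation h = steps 0 J h (cst 0).
Proof.
move=> J0 Jh; rewrite /path_expectation; case: xgetP => [v _ [J' [J'0 J'h ->]]|].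
  exact: steps_irrelevant.
by move=> /(_ (steps 0 J h (cst 0)))[]; exists J.
Qed.

Lemma cylinder_join h k : cylinder h -> cylinder k ->
  exists J, [/\ path <=%R 0 J, cylinder_on J h & cylinder_on J k].
Proof.
move=> [J J0 Jh] [J' J0' Jk]; exists (sort <=%R (J ++ J')); split.
- rewrite le_path_sortedE sort_le_sorted andbT; apply/allP => u.
  rewrite mem_sort mem_cat; move: J0 J0'; rewrite !le_path_sortedE.
  by move=> /andP[/allP J0 _] /andP[/allP J0' _] /orP[/J0|/J0'].
- by apply: cylinder_on_sub Jh => u uJ; rewrite mem_sort mem_cat uJ.
- by apply: cylinder_on_sub Jk => u uJ; rewrite mem_sort mem_cat uJ orbT.
Qed.

Lemma cylinder_on_cst J c : cylinder_on J (cst c).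
Proof.
split; last by exists `|c|.
by move=> e e0; exists 1 => // w w' _; rewrite subrr normr0 ltW.
Qed.

Lemma cylinder_on_lin J a h k : cylinder_on J h -> cylinder_on J k ->
  cylinder_on J (fun w => a * h w + k w).
Proof.
move=> [hu [C hC]] [ku [D kD]]; split; last first.
  exists (`|a| * C + D) => w; apply: (le_trans (ler_normD _ _)).
  by rewrite normrM; apply: lerD => //; exact: ler_wpM2l.
move=> e e0; have ea0 : 0 < e / (2 * (`|a| + 1)).
  by rewrite divr_gt0// mulr_gt0// ltr_wpDl.
have e20 : 0 < e / 2 by rewrite divr_gt0.
have [d d0 dP] := hu _ ea0; have [d' d'0 d'P] := ku _ e20.
exists (Num.min d d') => [|w w' ww']; first by rewrite lt_min d0.
have -> : a * h w + k w - (a * h w' + k w') =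
    a * (h w - h w') + (k w - k w') by ring.
apply: (le_trans (ler_normD _ _)); rewrite normrM [leRHS]splitr lerD//.
  apply: (@le_trans _ _ (`|a| * (e / (2 * (`|a| + 1))))).
    apply: ler_wpM2l => //; apply: dP => u /ww'.
    by rewrite lt_min => /andP[].
  have a1 : 0 < `|a| + 1 by rewrite ltr_wpDl.
  rewrite mulrA ler_pdivrMr ?mulr_gt0//.
  by have := normr_ge0 a; intro_nra.
by apply: d'P => u /ww'; rewrite lt_min => /andP[].
Qed.

Lemma cylinder_on_max J h k : cylinder_on J h -> cylinder_on J k ->
  cylinder_on J (fun w => Num.max (h w) (k w)).
Proof.
move=> [hu [C hC]] [ku [D kD]]; split; last first.
  exists (C + D) => w; have := hC w; have := kD w.
  have := normr_ge0 (h w); have := normr_ge0 (k w).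
  by case: (leP (h w) (k w)); intro_lra.
move=> e e0; have [d d0 dP] := hu _ e0; have [d' d'0 d'P] := ku _ e0.
exists (Num.min d d') => [|w w' ww']; first by rewrite lt_min d0.
have : `|h w - h w'| <= e by apply: dP => u /ww'; rewrite lt_min => /andP[].
have : `|k w - k w'| <= e by apply: d'P => u /ww'; rewrite lt_min => /andP[].
rewrite !ler_norml => /andP[? ?] /andP[? ?]; apply/andP.
by split; case: (leP (h w) (k w)); case: (leP (h w') (k w')); intro_lra.
Qed.

Lemma cylinder_lattice : function_lattice cylinder.
Proof.
split=> [c|a h k ch ck|h k ch ck|h [J _ [_ //]]].
- by exists [::] => //; exact: cylinder_on_cst.
- have [J [J0 Jh Jk]] := cylinder_join ch ck; exists J => //.
  exact: cylinder_on_lin.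
- have [J [J0 Jh Jk]] := cylinder_join ch ck; exists J => //.
  exact: cylinder_on_max.
Qed.

Lemma steps_le J s ts h k w : path <=%R s ts -> cylinder_on J h ->
  cylinder_on J k -> (forall w, h w <= k w) -> steps s ts h w <= steps s ts k w.
Proof.
move=> + Jh Jk hk; elim: ts s w => [//|t ts IHts] s w /= /andP[st tts].
have st0 : 0 <= t - s by rewrite subr_ge0.
apply: (expectation_monotone (E_convex st0)) => [||y]; last exact: IHts.
  by apply: (@cylinder_on_jump_BUC J); exact: cylinder_on_steps.
by apply: (@cylinder_on_jump_BUC J); exact: cylinder_on_steps.
Qed.

Lemma cylinder_on_scale J a h : cylinder_on J h -> cylinder_on J (fun w => a * h w).
Proof.
move=> Jh; move: (cylinder_on_lin a Jh (cylinder_on_cst J 0)).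
by congr cylinder_on; apply/funext => w; rewrite addr0.
Qed.

Lemma steps_convex J s ts h k l w : path <=%R s ts -> cylinder_on J h ->
  cylinder_on J k -> 0 <= l <= 1 ->
  steps s ts (fun w => l * h w + (1 - l) * k w) w <=
  l * steps s ts h w + (1 - l) * steps s ts k w.
Proof.
move=> + Jh Jk l01; elim: ts s w => [//|t ts IHts] s w /= /andP[st tts].
have st0 : 0 <= t - s by rewrite subr_ge0.
have Jh' := cylinder_on_jump_BUC w t (cylinder_on_steps tts Jh).
have Jk' := cylinder_on_jump_BUC w t (cylinder_on_steps tts Jk).
apply: le_trans (Defs.expectation_convex (E_convex st0) Jh' Jk' l01).
apply: (expectation_monotone (E_convex st0)) => [||y]; last exact: IHts.
  apply: (@cylinder_on_jump_BUC J); apply: cylinder_on_steps => //.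
  by apply: cylinder_on_lin => //; exact: cylinder_on_scale.
have := cylinder_on_lin l (cylinder_on_steps tts Jh)
  (cylinder_on_scale (1 - l) (cylinder_on_steps tts Jk)).
exact: cylinder_on_jump_BUC.
Qed.

Lemma path_expectation_convex : convex_expectation cylinder path_expectation.
Proof.
split=> [h k ch ck hk|c|h k l ch ck l01].
- have [J [J0 Jh Jk]] := cylinder_join ch ck.
  by rewrite !(path_expectationE J0)//; exact: (@steps_le J).
- by rewrite (@path_expectationE [::] (cst c))//; exact: cylinder_on_cst.
- have [J [J0 Jh Jk]] := cylinder_join ch ck.
  rewrite !(path_expectationE J0)//; first exact: (@steps_convex J).
  by apply: cylinder_on_lin => //; exact: cylinder_on_scale.
Qed.

(** Paths built by [steps] from [cst 0] are constant after their last jump time. Only for such paths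
    is the difference [w (s + t) - w s], after a further jump at [s + t > s], the jump itself. *)
Definition constant_after w (s : R) : Prop := forall u, s <= u -> w u = w s.

Lemma steps_eq_constant_after s ts h k w : path <=%R s ts ->
  constant_after w s ->
  (forall w, constant_after w (last s ts) -> h w = k w) ->
  steps s ts h w = steps s ts k w.
Proof.
elim: ts s w => [|t ts IHts] s w /=; first by move=> _ ws ->.
move=> /andP[st tts] ws hk; rewrite /step; congr (E _ _); apply/funext => y.
apply: IHts => // u tu; rewrite /jump tu lexx; congr (_ + _).
by rewrite ws ?(le_trans st tu)// [RHS]ws.
Qed.

(** Joint uniformity in the path and in [z] makes a cylinder function both of inserting an increment
    for [z] and of integrating [z] out. *)
Definition cylinder_kernel_on J (F : path_space -> G -> R) : Prop :=
  (forall e, 0 < e -> exists2 d, 0 < d & forall w w' z z',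
     (forall u, u \in J -> gdist (w u) (w' u) < d) -> gdist z z' < d ->
     `|F w z - F w' z'| <= e) /\
  exists C, forall w z, `|F w z| <= C.

Lemma cylinder_kernel_BUC J F w : cylinder_kernel_on J F -> BUC (F w).
Proof.
move=> [Fu [C FC]]; apply/BUC_P; split; last by exists C.
move=> e /Fu[d d0 dP]; exists d => // x y xy; apply: dP => // u _.
by rewrite gdistxx.
Qed.

Lemma cylinder_kernel_expectation J F t : 0 <= t -> cylinder_kernel_on J F ->
  cylinder_on J (fun w => E t (F w)).
Proof.
move=> t0 JF; have [Fu [C FC]] := JF; split.
  move=> e /Fu[d d0 dP]; exists d => // w w' ww'.
  apply: dist_le => //; try exact: cylinder_kernel_BUC JF.
  by move=> z; apply: dP => //; rewrite gdistxx.
by exists C => w; apply: norm_le => //; exact: cylinder_kernel_BUC JF.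
Qed.

Lemma cylinder_kernel_increment J F s r : cylinder_kernel_on J F -> s \in J ->
  cylinder_on (rcons J r) (fun w => F w (w r - w s)).
Proof.
move=> [Fu [C FC]] sJ; split; last by exists C.
move=> e /Fu[d d0 dP]; exists (d / 2) => [|w w' ww']; first by rewrite divr_gt0.
have d2 : d / 2 < d by intro_lra.
apply: dP => [u uJ|].
  by apply: lt_trans d2; apply: ww'; rewrite mem_rcons inE uJ orbT.
apply: (le_lt_trans (gdistB _ _ _ _)); rewrite [ltRHS]splitr.
by apply: ltrD; apply: ww'; rewrite mem_rcons inE ?sJ ?orbT ?eqxx.
Qed.

Lemma path_rcons_increment ts s t : path <=%R 0 (rcons ts s) -> 0 <= t ->
  path <=%R 0 (rcons (rcons ts s) (s + t)).
Proof. by move=> p0 t0; rewrite rcons_path p0 last_rcons lerDl. Qed.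

(** Independence and stationarity of the increments at once: the last of the [steps] averages
    exactly the increment over [[s, s + t]], by [E t] and with the earlier path held fixed. *)
Lemma path_expectation_increment ts s t F : path <=%R 0 (rcons ts s) -> 0 <= t ->
  cylinder_kernel_on (rcons ts s) F ->
  path_expectation (fun w => F w (w (s + t) - w s)) =
  path_expectation (fun w => E t (F w)).
Proof.
move=> p0 t0 JF; set J := rcons ts s in p0 JF *.
have sJ : s \in J by rewrite mem_rcons inE eqxx.
have J_le u : u \in J -> u <= s.
  rewrite {}/J in p0 {JF sJ} *.
  elim: ts 0 p0 => [|r ts IHts] x /=; first by rewrite inE => _ /eqP->.
  move=> /andP[_ prts]; rewrite inE => /predU1P[->|]; last exact: IHts prts.
  move: prts; rewrite le_path_sortedE => /andP[/allP/(_ s)].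
  by rewrite mem_rcons inE eqxx => /(_ isT).
have F_eq w w' z : (forall u, u \in J -> w u = w' u) -> F w z = F w' z.
  move=> ww'; apply/eqP; rewrite -subr_eq0 -normr_le0.
  apply/ler_addgt0Pr => e e0; rewrite add0r; have [d d0 dP] := JF.1 e e0.
  by apply: dP => [u uJ|]; rewrite ?ww' ?gdistxx.
rewrite (path_expectationE (path_rcons_increment p0 t0)
  (cylinder_kernel_increment _ JF sJ)).
rewrite (path_expectationE p0 (cylinder_kernel_expectation t0 JF)).
rewrite steps_rcons last_rcons; apply: steps_eq_constant_after => // w.
rewrite last_rcons => ws; rewrite /step [s + t]addrC addrK addrC.
(* For [t = 0] the jump falls at [s] itself and cancels in the increment, so the two integrands
   differ; [E_0] evaluates both at the jump [0]. *)
have [t_eq0|t_neq0] := eqVneq t 0.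
  rewrite t_eq0 addr0 !E_0; last 2 first.
  - exact: cylinder_kernel_BUC JF.
  - have := cylinder_kernel_increment s JF sJ.
    exact: cylinder_on_jump_BUC.
  rewrite subrr; apply: F_eq => u _; rewrite /jump.
  by case: ifP; rewrite addr0.
congr (E _ _); apply/funext => y.
have st : s < s + t by rewrite ltrDl lt_def t_neq0.
rewrite {2 3}/jump lexx leNgt st /= addr0 ws ?ltW// addrAC subrr add0r.
apply: F_eq => u /J_le us; rewrite /jump leNgt (le_lt_trans us st).
by rewrite addr0.
Qed.

End path_expectation.

(** * Subgradients of a convex expectation *)

Section subgradient.
Variables (R : realType) (T : Type) (M : set (T -> R)) (E : (T -> R) -> R).
Hypotheses (HM : function_lattice M) (HE : convex_expectation M E).

Let M_affine (a b : R) X : M X -> M (fun w => a * X w + b).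
Proof. by move=> MX; exact: lattice_lin HM _ _ _ MX (lattice_cst HM b). Qed.

(* A linear functional below the directional derivatives of [E] at [f]. *)
Lemma expectation_subgradient f : M f -> exists L : (T -> R) -> R,
  [/\ forall a g h, M g -> M h -> L (fun w => a * g w + h w) = a * L g + L h,
      forall g h, M g -> M h -> (forall w, g w <= h w) -> L g <= L h,
      forall c, L (cst c) = c &
      forall g, M g -> L g - (L f - E f) <= E g].
Proof.
move=> Mf; pose q g l := (E (fun w => f w + l * g w) - E f) / l.
have Mfl g l : M g -> M (fun w => f w + l * g w).
  move=> Mg; move: (lattice_lin HM l Mg Mf); congr M.
  by apply/funext => w; rewrite addrC.
have qlb g : M g -> exists K, forall l, 0 < l -> - K <= q g l.
  move=> Mg; have [K gK] := lattice_bounded HM Mg; exists K => l l0.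
  rewrite /q ler_pdivlMr//.
  have : `|E (fun w => f w + l * g w) - E f| <= l * K.
    apply: (expectation_dist_le M_affine HE) => // [|w]; first exact: Mfl.
    by rewrite addrAC subrr add0r normrM gtr0_norm// ler_pM2l.
  by rewrite ler_norml => /andP[? _]; intro_lra.
pose A g := [set q g l | l in [set l | 0 < l]].
pose p (g : T -> R^o) := inf (A g).
have pinf g : M g -> has_inf (A g).
  move=> Mg; split; first by exists (q g 1), 1; rewrite //= ltr01.
  by have [K qK] := qlb g Mg; exists (- K) => _ [l l0 <-]; exact: qK.
have p_le g l : M g -> 0 < l -> p g <= q g l.
  by move=> /pinf[_ lb] l0; apply: ge_inf => //; exists l.
have le_p g c : (forall l, 0 < l -> c <= q g l) -> c <= p g.
  move=> cq; apply: lb_le_inf; first by exists (q g 1), 1; rewrite //= ltr01.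
  by move=> _ [l l0 <-]; exact: cq.
have p_app g e : M g -> 0 < e -> exists2 l, 0 < l & q g l < p g + e.
  by move=> /pinf Hg e0; have [_ [l l0 <-] ?] := inf_adherent e0 Hg; exists l.
have M0 : M (0 : T -> R^o) := lattice_cst HM 0.
have MD (x y : T -> R^o) : M x -> M y -> M (x + y) by exact: latticeD HM x y.
have MZ (a : R) (x : T -> R^o) : M x -> M (a *: x) by exact: latticeZ HM a x.
have psub : sublinear_on M p.
  split=> [g h Mg Mh|a g a0 Mg].
    apply/ler_addgt0Pr => e e0; have e20 : 0 < e / 2 by rewrite divr_gt0.
    have [l l0 ql] := p_app g _ Mg e20; have [m m0 qm] := p_app h _ Mh e20.
    have lm0 : 0 < l + m by rewrite addr_gt0.
    (* With this step length, [f + r (g + h)] is the convex combination of [f + l g] and [f + m h]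
       with weights [m / (l + m)] and [l / (l + m)]. *)
    have r0 : 0 < l * m / (l + m) by rewrite divr_gt0// mulr_gt0.
    apply: (le_trans (p_le (g + h) _ (MD _ _ Mg Mh) r0)).
    suff : q (g + h) (l * m / (l + m)) <= q g l + q h m by intro_lra.
    have b01 : 0 <= m / (l + m) <= 1.
      rewrite divr_ge0 ?(ltW m0) ?(ltW lm0)//=.
      by rewrite ler_pdivrMr// mul1r lerDr ltW.
    have lmn : l + m != 0 by rewrite gt_eqF.
    have ln : l != 0 by rewrite gt_eqF.
    have mn : m != 0 by rewrite gt_eqF.
    have := Defs.expectation_convex HE (Mfl g l Mg) (Mfl h m Mh) b01.
    have -> : (fun w => m / (l + m) * (f w + l * g w) +
        (1 - m / (l + m)) * (f w + m * h w)) =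
        (fun w => f w + l * m / (l + m) * (g + h) w).
      apply/funext => w.
      by transitivity (f w + l * m / (l + m) * (g w + h w)) => //; field.
    move=> H; rewrite /q ler_pdivrMr//; rewrite lerBlDr; apply: (le_trans H).
    by rewrite le_eqVlt; apply/orP; left; apply/eqP; field; rewrite ln mn lmn.
  have [->|an0] := eqVneq a 0.
    rewrite mul0r scale0r; apply: (le_trans (p_le 0 _ M0 ltr01)).
    rewrite /q (_ : (fun w => _) = f) ?subrr ?mul0r//.
    by apply/funext => w; rewrite mul1r addr0.
  have a_gt0 : 0 < a by rewrite lt_def an0.
  rewrite mulrC -ler_pdivrMr//; apply: le_p => l l0.
  rewrite ler_pdivrMr//.
  have la0 : 0 < l / a by rewrite divr_gt0.
  apply: (le_trans (p_le _ _ (MZ a _ Mg) la0)); rewrite /q.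
  have -> : (fun w => f w + l / a * (a *: g) w) = (fun w => f w + l * g w).
    apply/funext => w; congr (_ + _).
    by transitivity (l / a * (a * g w)) => //; field.
  by rewrite invf_div mulrA mulrAC.
have [L [LD LZ Lp]] := hahn_banach M0 MD MZ psub.
have L_le g : M g -> L g <= E (fun w => f w + g w) - E f.
  move=> Mg; apply: (le_trans (Lp g Mg)); apply: (le_trans (p_le g _ Mg ltr01)).
  rewrite /q divr1 (_ : (fun w => _) = (fun w => f w + g w))//.
  by apply/funext => w; rewrite mul1r.
have Llin a g h : M g -> M h -> L (fun w => a * g w + h w) = a * L g + L h.
  by move=> Mg Mh; rewrite -LZ// -LD//; exact: MZ.
have LB g h : M g -> M h -> L (fun w => g w - h w) = L g - L h.
  move=> Mg Mh; rewrite -[- L h]mulN1r [RHS]addrC -Llin//; congr L.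
  by apply/funext => w; rewrite mulN1r addrC.
have Lcst c : L (cst c) = c.
  have Lc c' : L (cst c') <= c'.
    have := L_le _ (lattice_cst HM c').
    by rewrite (expectation_shift M_affine HE)//; intro_lra.
  apply/le_anti; rewrite Lc /=.
  have := LB _ _ (lattice_cst HM 0) (lattice_cst HM c).
  rewrite (_ : (fun _ => _) = cst (- c)); last first.
    by apply/funext => w /=; rewrite sub0r.
  have := Lc (- c); have := LB _ _ (lattice_cst HM 0) (lattice_cst HM 0).
  rewrite (_ : (fun _ => _) = cst 0); last by apply/funext => w /=; rewrite subrr.
  by intro_lra.
exists L; split=> // [g h Mg Mh gh|g Mg].
  rewrite -subr_le0 -LB//; apply: (le_trans (L_le _ (latticeB HM Mg Mh))).
  rewrite subr_le0; apply: (expectation_monotone HE) => // [|w].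
    exact: latticeD Mf (latticeB HM Mg Mh).
  by have := gh w; intro_lra.
have := L_le _ (latticeB HM Mg Mf); rewrite LB//.
rewrite (_ : (fun w => _) = g); last by apply/funext => w; rewrite addrC subrK.
by intro_lra.
Qed.

End subgradient.

(** * Continuity of dominated linear functionals *)

Section ultrafilter_facts.
Variables (I : Type) (U : set_system I).
Context {UU : UltraFilter U}.

Lemma ultrafilter_exists_ord (A : nat -> set I) k :
  U [set N | exists2 j, (j < k)%N & A j N] -> exists j, U (A j).
Proof.
elim: k => [|k IHk] UA.
  by exfalso; apply: (@filter_not_empty _ U _); apply: filterS UA => N [].
have [Ak|nAk] := in_ultra_setVsetC (A k) UU; first by exists k.
apply: IHk; apply: filterS (filterI UA nAk) => N [[j jk AjN] nAkN]; exists j => //.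
move: jk; rewrite ltnS leq_eqVlt => /predU1P[jk|//].
by rewrite jk in AjN.
Qed.

End ultrafilter_facts.

Lemma filter_forall_seq (I : Type) (K : eqType) (F : set_system I) (s : seq K)
    (A : K -> set I) : Filter F ->
  (forall t, t \in s -> F (A t)) -> F [set N | forall t, t \in s -> A t N].
Proof.
move=> FF; elim: s => [|t s IHs] FA; first exact: filterE.
have Fs := IHs (fun u us => FA u (mem_behead (s := t :: s) us)).
apply: filterS (filterI (FA t (mem_head _ _)) Fs) => N [AtN AsN] u.
by rewrite inE => /predU1P[->//|]; exact: AsN.
Qed.

Section dominated_functionals.
Variables (R : realType) (G : invariantMetricGroup R).
Hypothesis G_complete : complete G.
Variable x_ : nat -> G.
Hypothesis x_dense : forall x e, 0 < e -> exists n, gdist x (x_ n) < e.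

(** The minimum of [1] and [p] times the distance to the first [k] dense points: a Lipschitz
    substitute for the indicator of the complement of finitely many balls of radius [1 / p]. *)
Fixpoint net (p k : nat) (x : G) : R :=
  if k is k'.+1 then Num.min (net p k' x) (p%:R * gdist x (x_ k')) else 1.

Lemma net_ge0 p k x : 0 <= net p k x.
Proof.
elim: k => [|k IHk] /=; first exact: ler01.
by rewrite le_min IHk mulr_ge0// gdist_ge0.
Qed.

Lemma net_le1 p k x : net p k x <= 1.
Proof. by elim: k => [|k IHk] //=; rewrite ge_min IHk. Qed.

Lemma net_lt1 p k x : net p k x < 1 ->
  exists2 j, (j < k)%N & p%:R * gdist x (x_ j) < 1.
Proof.
elim: k => [|k IHk] /=; first by rewrite ltxx.
rewrite gt_min => /orP[/IHk[j jk jx]|kx]; last by exists k.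
by exists j => //; exact: ltnW.
Qed.

Lemma net_lipschitz p k x y : `|net p k x - net p k y| <= p%:R * gdist x y.
Proof.
elim: k => [|k] /=; first by rewrite subrr normr0 mulr_ge0// gdist_ge0.
have h1 : p%:R * gdist x (x_ k) <= p%:R * gdist x y + p%:R * gdist y (x_ k).
  by rewrite -mulrDr ler_wpM2l// gdist_triangle.
have h2 : p%:R * gdist y (x_ k) <= p%:R * gdist x y + p%:R * gdist x (x_ k).
  by rewrite -mulrDr ler_wpM2l// [gdist x y]gdistC gdist_triangle.
move: h1 h2; move: (_ * gdist x (x_ k)) (_ * gdist y (x_ k)) => a b h1 h2.
rewrite !ler_norml => /andP[? ?]; apply/andP.
by split; case: (leP (net p k x) a); case: (leP (net p k y) b); intro_lra.
Qed.

Lemma net_BUC p k : BUC (net p k).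
Proof.
apply/BUC_P; split; last first.
  by exists 1 => x; rewrite ger0_norm ?net_ge0// net_le1.
move=> e e0; exists (e / (p%:R + 1)) => [|x y xy].
  by rewrite divr_gt0// ltr_wpDl.
apply: (le_trans (net_lipschitz _ _ _ _)).
have p1 : 0 < p%:R + 1 :> R by rewrite ltr_wpDl.
move: xy; rewrite ltr_pdivlMr// => xy.
by have := gdist_ge0 x y; intro_nra.
Qed.

Lemma net_nonincreasing p x : nonincreasing_seq (fun k => net p k x).
Proof. by apply/nonincreasing_seqP => k /=; rewrite ge_min lexx. Qed.

Lemma net_cvg0 p x e : 0 < e -> exists k, net p k x <= e.
Proof.
move=> e0; have p1 : 0 < p%:R + 1 :> R by rewrite ltr_wpDl.
have [k xk] := x_dense x (divr_gt0 e0 p1); exists k.+1 => /=.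
rewrite ge_min; apply/orP; right; move: xk; rewrite ltr_pdivlMr//.
by have := gdist_ge0 x (x_ k); intro_nra.
Qed.

Local Notation path_space := (R -> G).

Variable E : R -> (G -> R) -> R.
Hypothesis E_above : forall t, 0 <= t -> forall g : nat -> G -> R,
  (forall k, BUC (g k)) -> (forall k x, 0 <= g k x) ->
  (forall x, nonincreasing_seq (g^~ x)) ->
  (forall x e, 0 < e -> exists k, g k x <= e) ->
  exists k, E t (g k) <= 1.

Variables (L : (path_space -> R) -> R) (a : R).
Local Notation M := (@cylinder R G).
Hypothesis L_lin : forall b g h, M g -> M h ->
  L (fun w => b * g w + h w) = b * L g + L h.
Hypothesis L_le : forall g h, M g -> M h -> (forall w, g w <= h w) -> L g <= L h.
Hypothesis L_cst : forall c, L (cst c) = c.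
Hypothesis L_dominated : forall t f, 0 <= t -> BUC f ->
  L (fun w => f (w t)) - a <= E t f.

Lemma cylinder_coordinate t (f : G -> R) : 0 <= t -> BUC f ->
  cylinder_on [:: t] (fun w : path_space => f (w t)).
Proof.
move=> t0 /BUC_P[fu [C fC]]; split; last by exists C.
move=> e /fu[d d0 dP]; exists d => // w w' ww'; apply: dP; apply: ww'.
by rewrite inE.
Qed.

Let M_coordinate t (f : G -> R) : 0 <= t -> BUC f ->
  M (fun w => f (w t)).
Proof. by move=> t0 Bf; exists [:: t]; rewrite /= ?t0//; exact: cylinder_coordinate. Qed.

Let LZ b g : M g -> L (fun w => b * g w) = b * L g.
Proof.
move=> Mg; have := L_lin b Mg (lattice_cst (@cylinder_lattice R G) 0).
by rewrite L_cst addr0 => <-; congr L; apply/funext => w; rewrite addr0.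
Qed.

(* Domination gives [l L(g) <= E t (l g) + a], so continuity from above of [E t]
   along [l net] makes [L(net)] small once [l] is large. *)
Lemma net_small t p e : 0 <= t -> 0 < e ->
  exists k, L (fun w => net p k (w t)) <= e.
Proof.
(* [E_above] supplies only the bound [1], so [l] times the value of [L] is at most [1 + a]; dividing
   by this [l] gives [e]. *)
move=> t0 e0; pose l := (`|a| + 1) / e.
have l0 : 0 < l by rewrite divr_gt0// ltr_wpDl.
have Bg k : BUC (fun x => l * net p k x).
  move: (BUC_affine l 0 (net_BUC p k)); congr BUC.
  by apply/funext => x; rewrite addr0.
have [k x|x m n mn|x e' e'0|k Ek] := E_above t0 Bg.
- by rewrite mulr_ge0 ?net_ge0// ltW.
- by rewrite ler_pM2l//; exact: net_nonincreasing.
- have [k Hk] := net_cvg0 p x (divr_gt0 e'0 l0); exists k.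
  by rewrite mulrC -ler_pdivlMr.
exists k; have := L_dominated t0 (Bg k).
rewrite LZ; last exact: (M_coordinate t0 (net_BUC p k)).
move=> H; rewrite -(ler_pM2l l0); apply: (@le_trans _ _ (`|a| + 1)).
  by have := ler_norm a; intro_lra.
by rewrite /l divfK// gt_eqF.
Qed.

(* If [h N <= e / 2 + C v N] fails for all [N], the points [w N] where it fails
   stay, coordinatewise, close to finite nets, hence converge along an
   ultrafilter to a path at which no [h m] is small. *)
Lemma dominated_daniell : daniell_functional M L.
Proof.
split=> // h Mh h0 h_nd h_small e e0.
have /choice[J_ HJ] : forall n, exists J, path <=%R 0 J /\ cylinder_on J (h n).
  by move=> n; have [J] := Mh n; exists J.
have [C [C0 hC]] : exists C, 0 < C /\ forall n w, h n w <= C.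
  have [_ _ [_ [C hC]]] := Mh 0%N; exists (`|C| + 1); split=> [|n w].
    by rewrite ltr_wpDl.
  apply: (le_trans (h_nd w _ _ (leq0n n))).
  rewrite (le_trans (ler_norm _))// (le_trans (hC w))//.
  by rewrite (le_trans (ler_norm C))// lerDl.
(* An enumeration of all pairs of a time in some [J_ n] and a precision [p]. Codes that decode to
   nothing or run past the end of [J_ n] give time [0], which is still admissible. *)
pose index i : R * nat :=
  if unpickle i is Some (n, j, p) then (nth 0 (J_ n) j, p) else (0, 0%N).
have index_ge0 i : 0 <= (index i).1.
  rewrite /index; case: (unpickle i) => [[[n j] p]|//] /=.
  have [jn|nj] := ltnP j (size (J_ n)); last by rewrite nth_default.
  have [] := HJ n; rewrite le_path_sortedE => /andP[/allP + _] _; apply.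
  exact: mem_nth.
have indexP n t p : t \in J_ n -> exists i, index i = (t, p).
  move=> tJ; exists (pickle (n, seq.index t (J_ n), p)).
  by rewrite /index pickleK nth_index.
(* Chosen so that [C * L (v N) <= C * eta = e / 2], the other half of [e] being the slack in the
   pointwise bound. *)
pose eta := e / (2 * C).
have eta0 : 0 < eta by rewrite divr_gt0// mulr_gt0.
have eta_i i : 0 < eta / 2 ^+ i.+1 by rewrite divr_gt0// exprn_gt0.
have /choice[k_ Hk] : forall i, exists k,
    L (fun w => net (index i).2 k (w (index i).1)) <= eta / 2 ^+ i.+1.
  by move=> i; exact: net_small.
pose u i (w : path_space) := net (index i).2 (k_ i) (w (index i).1).
have Mu i : M (u i) by apply: (M_coordinate (index_ge0 i)); exact: net_BUC.
pose v N w := \sum_(i < N) u i w.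
have Mv N : M (v N) by exact: (lattice_sum (@cylinder_lattice R G)).
have Lv N : L (v N) <= eta * (1 - (2 ^+ N)^-1).
  elim: N => [|N IHN].
    rewrite expr0 invr1 subrr mulr0 -[leRHS](L_cst 0) le_eqVlt; apply/orP; left.
    by apply/eqP; congr L; apply/funext => w; rewrite /v big_ord0.
  have -> : v N.+1 = (fun w => 1 * u N w + v N w).
    by apply/funext => w; rewrite /v big_ord_recr/= mul1r addrC.
  rewrite L_lin// mul1r; apply: (le_trans (lerD (Hk N) IHN)).
  rewrite le_eqVlt; apply/orP; left; apply/eqP; rewrite exprS; field.
  by rewrite expf_neq0.
suff [N HN] : exists N, forall w, h N w <= e / 2 + C * v N w.
  exists N; have MCv : M (fun w => C * v N w + e / 2).
    exact: lattice_lin (@cylinder_lattice R G) _ _ _ (Mv N) (lattice_cst (@cylinder_lattice R G) _).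
  apply: (@le_trans _ _ (C * L (v N) + e / 2)).
    rewrite -[X in _ + X](L_cst (e / 2)) -L_lin//; last first.
      exact: (lattice_cst (@cylinder_lattice R G)).
    by apply: L_le => // w; rewrite addrC; exact: HN.
  have : L (v N) <= eta.
    apply: (le_trans (Lv N)).
    by rewrite ler_piMr ?(ltW eta0)// gerBl invr_ge0 exprn_ge0.
  rewrite /eta ler_pdivlMr ?mulr_gt0// => H.
  have : L (v N) * (2 * C) = 2 * (C * L (v N)) by ring.
  by intro_lra.
apply: contrapT => /forallNP H.
have /choice[w_ Hw] : forall N, exists w, e / 2 + C * v N w < h N w.
  move=> N; apply: contrapT => /forallNP Hw; apply: (H N) => w.
  by rewrite leNgt; apply/negP; exact: Hw.
(* As [h N <= C], failure of the bound at [w_ N] forces [v N (w_ N) < 1], hence each of its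
   nonnegative summands is below [1]. *)
have u_lt1 i N : (i < N)%N -> u i (w_ N) < 1.
  move=> iN; have : v N (w_ N) < 1.
    rewrite -(ltr_pM2l C0) mulr1; have := hC N (w_ N); have := Hw N.
    by intro_lra.
  apply: le_lt_trans; rewrite /v (bigD1 (Ordinal iN))//= lerDl.
  by apply: sumr_ge0 => j _; exact: net_ge0.
(* An ultrafilter finer than the eventual one replaces a diagonal extraction over the countably many
   times. *)
have [U [UU sU]] := ultraFilterLemma (eventually_filter).
have Ucvg n t : t \in J_ n ->
    exists y, forall d, 0 < d -> U [set N | gdist (w_ N t) y < d].
  move=> tJ; pose F : set_system G := [set B | U [set N | B (w_ N t)]].
  have FF : ProperFilter F by exact: (fmap_proper_filter (w_^~ t)).
  have : cvg F.
    apply: G_complete => //; apply/cauchy_exP => d d0.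
    pose p := Num.bound `|d^-1|.
    have dp : 1 <= p%:R * d.
      rewrite -ler_pdivrMr// div1r (le_trans (ler_norm _))// ltW//.
      exact: archi_boundP.
    have [i iE] := indexP n t p tJ.
    (* Eventually [w_ N t] is within [1 / p <= d] of one of the first [k_ i] dense points. The
       ultrafilter selects one of these finitely many points, which makes [F] Cauchy. *)
    have : U [set N | exists2 j, (j < k_ i)%N & gdist (x_ j) (w_ N t) < d].
      apply: sU; exists i.+1 => // N /= iN.
      have := u_lt1 i N iN; rewrite /u iE /= => /net_lt1[j jk].
      move=> /(fun H => lt_le_trans H dp); rewrite gdistC ltr_pM2l.
        by exists j.
      by rewrite -(ltr_pM2r d0) mul0r (lt_le_trans ltr01 dp).
    by move=> /ultrafilter_exists_ord[j Hj]; exists (x_ j).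
  move=> Fl; exists (lim F) => d d0.
  have FB := Fl _ (nbhsx_ballx (lim F) d d0).
  by apply: (@filterS _ U _ _ _ _ FB) => N /=; rewrite gdist_ballE /= gdistC.
pose y t := xget 0 [set z | forall d, 0 < d -> U [set N | gdist (w_ N t) z < d]].
have yP n t d : t \in J_ n -> 0 < d -> U [set N | gdist (w_ N t) (y t) < d].
  move=> /Ucvg[z Hz]; rewrite /y; case: xgetP => [z' -> |/(_ z)/(_ Hz)//].
  exact.
have e40 : 0 < e / 4 by rewrite divr_gt0.
have e80 : 0 < e / 8 by rewrite divr_gt0.
have [m hm] := h_small y _ e80.
have [d d0 dP] := (HJ m).2.1 _ e40.
(* For a suitable [N >= m], [h N (w_ N) <= h m (w_ N) <= h m y + e / 4 <= 3 e / 8], against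
   [h N (w_ N) > e / 2]. *)
have Um : U [set N | (m <= N)%N] by apply: sU; exists m.
have := filterI Um (filter_forall_seq _ (fun t tJ => yP m t d tJ d0)).
move=> /(_ _ _)/filter_ex[N [/= mN wy]].
have := dP _ _ wy; rewrite ler_norml => /andP[_].
have := h_nd (w_ N) _ _ mN; have := Hw N.
have : 0 <= C * v N (w_ N).
  by apply: mulr_ge0; [exact: ltW|apply: sumr_ge0 => i _; exact: net_ge0].
by intro_lra.
Qed.

End dominated_functionals.

(** * Representation by countably additive expectations *)

Section expectation_extension.
Variables (R : realType) (T : pointedType) (M : set (T -> R)).
Variable E : (T -> R) -> R.
Hypotheses (HM : function_lattice M) (HE : convex_expectation M E).
Hypothesis E_daniell : forall (L : (T -> R) -> R) (a : R),
  (forall b g h, M g -> M h -> L (fun w => b * g w + h w) = b * L g + L h) ->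
  (forall g h, M g -> M h -> (forall w, g w <= h w) -> L g <= L h) ->
  (forall c, L (cst c) = c) ->
  (forall g, M g -> L g - a <= E g) -> daniell_functional M L.

Local Notation TM := (g_sigma_algebraType (positivity_sets M)).

(* The robust representation [sup (J X - a)], over the countably additive linear
   expectations [J] and constants [a] such that [J - a <= E] on [M]. *)
Lemma expectation_extension : exists F : (TM -> R) -> R,
  convex_expectation_space F /\ forall f, M f -> F f = E f.
Proof.
pose P (Ja : ((TM -> R) -> R) * R) := linear_expectation Ja.1 /\
  forall g, M g -> Ja.1 g - Ja.2 <= E g.
pose A (X : TM -> R) := [set Ja.1 X - Ja.2 | Ja in P].
pose F X := sup (A X).
(* On [M] the supremum is attained, by the extension of a subgradient at [f]; hence [F] extends
   [E]. *)
have exP f : M f -> exists2 Ja, P Ja & Ja.1 f - Ja.2 = E f.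
  move=> Mf; have [L [Llin Lle Lcst Ldom]] := expectation_subgradient HM HE Mf.
  have HL := E_daniell Llin Lle Lcst Ldom.
  have [J [HJ JL]] := daniell_extension HM HL.
  exists (J, L f - E f); last by rewrite /= JL// opprB addrC subrK.
  by split=> //= g Mg; rewrite JL//; exact: Ldom.
have J_cst J c : linear_expectation J -> J (cst c) = c :> R.
  by move=> [_ [HJ _]]; exact: (Defs.expectation_cst HJ).
have J_le J X Y : linear_expectation J -> Linfty X -> Linfty Y ->
    (forall w, X w <= Y w) -> J X <= J Y :> R.
  by move=> [_ [HJ _]]; exact: (expectation_monotone HJ).
(* Constants belong to [M], so domination there already bounds every [J - a] on all bounded
   measurable functions and keeps the supremum finite. *)
have P_le (Ja : ((TM -> R) -> R) * R) (X : TM -> R) c :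
    P Ja -> Linfty X -> (forall w, X w <= c) -> Ja.1 X - Ja.2 <= c.
  move=> [HJ JE] LX Xc; apply: (@le_trans _ _ (Ja.1 (cst c) - Ja.2)).
    by rewrite lerD2r; apply: J_le => //; exact: Linfty_cst.
  apply: le_trans (JE _ (lattice_cst HM c)) _.
  by rewrite (Defs.expectation_cst HE).
have [Ja0 PJa0 Ja0E] := exP _ (lattice_cst HM 0).
have A_sup (X : TM -> R) : Linfty X -> has_sup (A X).
  move=> LX; split; first by exists (Ja0.1 X - Ja0.2), Ja0.
  have /LinftyP[_ [C XC]] := LX; exists C => _ [Ja PJa <-].
  by apply: P_le => // w; exact: le_trans (ler_norm _) (XC w).
have F_ge X Ja : Linfty X -> P Ja -> Ja.1 X - Ja.2 <= F X.
  by move=> /A_sup[_ ub] PJa; apply: ub_le_sup => //; exists Ja.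
have F_le X c : (forall Ja, P Ja -> Ja.1 X - Ja.2 <= c) -> F X <= c.
  move=> H; apply: ge_sup; first by exists (Ja0.1 X - Ja0.2), Ja0.
  by move=> _ [Ja PJa <-]; exact: H.
have FE f : M f -> F f = E f.
  move=> Mf; apply/le_anti/andP; split; first by apply: F_le => Ja [_]; exact.
  have [Ja PJa <-] := exP f Mf; apply: F_ge => //.
  exact: lattice_Linfty.
have F_mono X Y : Linfty X -> Linfty Y -> (forall w, X w <= Y w) -> F X <= F Y.
  move=> LX LY XY; apply: F_le => Ja PJa; apply: le_trans (F_ge Y Ja LY PJa).
  by rewrite lerD2r; apply: J_le => //; exact: PJa.1.
exists F; split=> //; split; first split=> //.
- move=> c; rewrite FE; last exact: lattice_cst.
  exact: (Defs.expectation_cst HE).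
- move=> X Y l LX LY /andP[l0 l1]; apply: F_le => Ja PJa.
  have l1' : 0 <= 1 - l by rewrite subr_ge0.
  have LlY : Linfty (fun w => (1 - l) * Y w).
    move: (Linfty_affine (1 - l) 0 LY); congr Linfty.
    by apply/funext => w; rewrite addr0.
  have JlY : Ja.1 (fun w => (1 - l) * Y w) = (1 - l) * Ja.1 Y.
    have := linear_expectation_lin PJa.1 (1 - l) LY (Linfty_cst _ 0).
    rewrite J_cst ?addr0; last exact: PJa.1.
    by move=> <-; congr (Ja.1 _); apply/funext => w; rewrite addr0.
  rewrite (linear_expectation_lin PJa.1)// JlY.
  have := ler_wpM2l l0 (F_ge X Ja LX PJa).
  have := ler_wpM2l l1' (F_ge Y Ja LY PJa).
  rewrite !mulrBr !mulrBl !mul1r.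
  by intro_lra.
move=> X_ X LX_ LX XX.
have XX' n w : X_ n w <= X w by have /increases_toP[] := XX w.
apply/increases_toP; split=> [|n|e e0]; last 2 first.
- exact: F_mono.
- have e20 : 0 < e / 2 by rewrite divr_gt0.
  have [_ [Ja PJa <-] HJa] := sup_adherent e20 (A_sup X LX).
  have := space_continuous_from_below (linear_expectation_space PJa.1) LX_ LX XX.
  move=> /increases_toP[_ _ /(_ _ e20)[n Hn]]; exists n.
  have := F_ge _ _ (LX_ n) PJa; rewrite -/(F X) in HJa.
  by intro_lra.
apply/nondecreasing_seqP => n; apply: F_mono => // w.
by have [/nondecreasing_seqP] := XX w.
Qed.

End expectation_extension.

(** * Approximation of bounded continuous functions from below *)

Section continuous_bounded_functions.
Variable R : realType.

Lemma continuous_ball (T : pseudoMetricType R) (f : T -> R) x e :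
  continuous f -> 0 < e ->
  exists2 d, 0 < d & forall y, ball x d y -> `|f x - f y| <= e.
Proof.
move=> cf e0; have /nbhs_ballP[d d0 dP] : nbhs x [set y | `|f x - f y| <= e].
  exact: (cvgrPdist_le _ _).1 (cf x) e e0.
by exists d.
Qed.

Variable G : invariantMetricGroup R.

Lemma BUC_Cb (f : G -> R) : BUC f -> Cb f.
Proof.
move=> Bf; have /BUC_P[fu fb] := Bf; split; last exact: Bf.2.
move=> x; have FF : Filter (nbhs x) := nbhs_filter x.
apply/(@cvgrPdist_le _ _ _ (nbhs x) FF) => e /fu[d d0 dP].
by apply/nbhs_ballP; exists d => // y xy; exact: dP.
Qed.

Lemma lipschitz_BUC (f : G -> R) (n : nat) (C : R) :
  (forall x y, `|f x - f y| <= n%:R * gdist x y) -> (forall x, `|f x| <= C) ->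
  BUC f.
Proof.
move=> fl fC; apply/BUC_P; split; last by exists C.
move=> e e0; have n1 : 0 < n%:R + 1 :> R by rewrite ltr_wpDl.
exists (e / (n%:R + 1)) => [|x y]; first by rewrite divr_gt0.
rewrite ltr_pdivlMr// => xy; apply: (le_trans (fl x y)).
by have := gdist_ge0 x y; intro_nra.
Qed.

(** Assuming only lower semicontinuity covers the indicators of open sets, from which the
    measurability of the coordinates is derived. *)
Lemma BUC_approximation_below (f : G -> R) C : (forall x, `|f x| <= C) ->
  (forall x e, 0 < e -> exists2 d, 0 < d & forall y, gdist x y < d -> f x - e <= f y) ->
  exists f_ : nat -> G -> R, (forall n, BUC (f_ n)) /\
    forall x, increases_to (f_^~ x) (f x).
Proof.
move=> fC fl.
have [f_ [f_l f_C ff]] := lipschitz_approximation_below (@gdistxx R G)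
  (@gdist_ge0 R G) (@gdistC R G) (fun x y z => gdist_triangle y x z) fC fl.
by exists f_; split=> // n; exact: lipschitz_BUC (f_l n) (f_C n).
Qed.

Lemma Cb_approximation_below (f : G -> R) : Cb f ->
  exists f_ : nat -> G -> R, (forall n, BUC (f_ n)) /\
    forall x, increases_to (f_^~ x) (f x).
Proof.
move=> [cf /bounded_fun_leP[C fC]]; apply: (BUC_approximation_below fC) => x e e0.
have [d d0 dP] := continuous_ball x cf e0; exists d => // y xy.
by have := dP y xy; rewrite ler_norml => /andP[_]; intro_lra.
Qed.

(** The inf-convolutions need a real-valued distance on the product; [rv_dist_ball] is its link to
    the product topology. *)
Definition rv_dist n (z z' : 'rV[G]_n * G) : R :=
  \sum_i gdist (z.1 0 i) (z'.1 0 i) + gdist z.2 z'.2.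

Lemma rv_dist_ball n (z z' : 'rV[G]_n * G) d : rv_dist z z' < d -> ball z d z'.
Proof.
move=> zz'; have s0 : 0 <= \sum_i gdist (z.1 0 i) (z'.1 0 i).
  by apply: sumr_ge0 => i _; exact: gdist_ge0.
have g0 := gdist_ge0 z.2 z'.2.
have d0 : 0 < d by apply: le_lt_trans zz'; exact: addr_ge0.
split => /=; last by apply: le_lt_trans zz'; rewrite lerDr.
split=> // i j; rewrite ord1; apply: le_lt_trans zz'.
rewrite /rv_dist (bigD1 j)//= -addrA lerDl addr_ge0//.
by apply: sumr_ge0 => k _; exact: gdist_ge0.
Qed.

Lemma Cb_rv_approximation_below n (f : 'rV[G]_n * G -> R) : Cb f ->
  exists C (f_ : nat -> 'rV[G]_n * G -> R),
    [/\ forall k z z', `|f_ k z - f_ k z'| <= k%:R * rv_dist z z',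
        forall k z, `|f_ k z| <= C, forall z, `|f z| <= C &
        forall z, increases_to (f_^~ z) (f z)].
Proof.
move=> [cf /bounded_fun_leP[C fC]]; exists C.
suff [f_ [f_l f_C ff]] : exists f_ : nat -> 'rV[G]_n * G -> R,
    [/\ forall k z z', `|f_ k z - f_ k z'| <= k%:R * rv_dist z z',
        forall k z, `|f_ k z| <= C & forall z, increases_to (f_^~ z) (f z)].
  by exists f_.
apply: lipschitz_approximation_below => //.
- by move=> z; rewrite /rv_dist gdistxx addr0 big1// => i _; rewrite gdistxx.
- by move=> z z'; rewrite addr_ge0 ?gdist_ge0//; apply: sumr_ge0 => i _; exact: gdist_ge0.
- by move=> z z'; rewrite /rv_dist gdistC; congr (_ + _); apply: eq_bigr => i _; rewrite gdistC.
- move=> z z' z''; rewrite /rv_dist addrACA -big_split/=; apply: lerD.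
    by apply: ler_sum => i _; exact: gdist_triangle.
  exact: gdist_triangle.
- move=> z e e0; have [d d0 dP] := continuous_ball z cf e0; exists d => // z' zz'.
  by have := dP z' (rv_dist_ball zz'); rewrite ler_norml => /andP[_]; intro_lra.
Qed.

End continuous_bounded_functions.

(** * The Levy process of a semigroup *)

Lemma separable_sequence (R : realType) (G : invariantMetricGroup R) :
  separable G ->
  exists x_ : nat -> G, forall x e, 0 < e -> exists n, gdist x (x_ n) < e.
Proof.
move=> [A [/countable_injP[f finj] Ad]].
exists (fun n => xget 0 [set x | A x /\ f x = n]) => x e e0.
have [||y [xy Ay]] := Ad (ball x e).
- by exists x; exact: ballxx.
- rewrite openE => y xy; apply/nbhs_ballP; exists (e - gdist x y) => /=.
    by rewrite subr_gt0.
  move=> z; rewrite gdist_ballE /= ltrBrDl => yz; rewrite gdist_ballE /=.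
  by apply: le_lt_trans yz; exact: gdist_triangle.
exists (f y); case: xgetP => [z _ [Az fz]|/(_ y)[]//].
by rewrite (finj z y) ?inE.
Qed.

Section semigroup_levy_process.
Variables (R : realType) (G : invariantMetricGroup R).
Variable S : R -> (G -> R) -> G -> R.
Hypothesis HS : convex_Markovian_convolution_semigroup S.
Hypothesis S_above : forall t, 0 <= t -> continuous_from_above (S t).

Let E (t : R) (f : G -> R) : R := S t f 0.

Lemma semigroup_expectation t : 0 <= t -> convex_expectation (@BUC R _) (E t).
Proof.
move=> t0; exact: (kernel_expectation (convolution_kernel (semigroup_convolution HS t0))).
Qed.

Lemma semigroup_translation t f x : 0 <= t -> BUC f ->
  S t f x = E t (fun y => f (x + y)).
Proof.
by move=> t0 Bf; exact: convolution_translation (semigroup_convolution HS t0) _ _ Bf.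
Qed.

Lemma semigroup_expectation0 f : BUC f -> E 0 f = f 0.
Proof. by move=> Bf; rewrite /E (semigroup0 HS). Qed.

Lemma semigroup_expectationD s t f : 0 <= s -> 0 <= t -> BUC f ->
  E (s + t) f = E s (fun x => E t (fun y => f (x + y))).
Proof.
move=> s0 t0 Bf; rewrite /E (semigroupD HS s0 t0 Bf); congr (S s _ 0).
by apply/funext => x; exact: semigroup_translation.
Qed.

Lemma semigroup_expectation_above t : 0 <= t -> forall g : nat -> G -> R,
  (forall k, BUC (g k)) -> (forall k x, 0 <= g k x) ->
  (forall x, nonincreasing_seq (g^~ x)) ->
  (forall x e, 0 < e -> exists k, g k x <= e) ->
  exists k, E t (g k) <= 1.
Proof.
move=> t0 g Bg g0 gnd gsmall.
have [|_] := S_above t0 Bg (BUC_cst G 0) _ 0.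
  move=> x; split=> //; apply/cvgrPdist_le => e e0.
  have [k Hk] := gsmall x e e0; exists k => // m /= km.
  by rewrite sub0r normrN ger0_norm// (le_trans (gnd x _ _ km)).
have -> : S t (cst 0) 0 = 0 := Defs.expectation_cst (semigroup_expectation t0) 0.
move=> H; have [N _ HN] := (cvgrPdist_le _ _).1 H 1 ltr01.
exists N; have := HN N (leqnn N); rewrite /= sub0r normrN.
exact: le_trans (ler_norm _).
Qed.

Lemma semigroup_expectation_cvg0 f : BUC f -> E t f @[t --> 0^'+] --> f 0.
Proof.
move=> Bf; apply/cvgrPdist_le => e e0.
have := (cvgrPdist_le _ _).1 (semigroup_cvg0 HS Bf) e e0.
move=> H; near=> t.
have t0 : 0 < t by near: t; exact: nbhs_right_gt.
have te : `|0 - sup_norm (fun x => S t f x - f x)| <= e by near: t; exact: H.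
have t0' := ltW t0; rewrite sub0r normrN in te.
rewrite distrC (le_trans _ te)// (le_trans _ (ler_norm _))// /sup_norm.
have /BUC_P[_ [C fC]] := Bf.
have /BUC_P[_ [D SD]] := kernel_BUC (convolution_kernel (semigroup_convolution HS t0')) Bf.
apply: ub_le_sup; last by exists 0.
exists (D + C) => _ [x _ <-]; apply: (le_trans (ler_normB _ _)).
exact: lerD.
Unshelve. all: by end_near. Qed.

Local Notation path_space := (R -> G).
Local Notation M := (@cylinder R G).
Local Notation E0 := (path_expectation E).
Local Notation Omega := (g_sigma_algebraType (positivity_sets M)).

Let E_convex := semigroup_expectation.
Let E_0 := semigroup_expectation0.
Let E_add := semigroup_expectationD.

Lemma coordinate_cylinder t (f : G -> R) : 0 <= t -> BUC f ->
  M (fun w => f (w t)).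
Proof. by move=> t0 Bf; exists [:: t]; rewrite /= ?t0//; exact: cylinder_coordinate. Qed.

Lemma path_expectation_coordinate t f : 0 <= t -> BUC f ->
  E0 (fun w => f (w t)) = E t f.
Proof.
move=> t0 Bf; have Jf := cylinder_coordinate t0 Bf.
rewrite (path_expectationE E_convex E_add _ Jf) /= ?t0//.
rewrite /step subr0; congr (E _ _); apply/funext => y.
by rewrite /jump lexx add0r.
Qed.

Hypothesis G_complete : complete G.
Variable x_ : nat -> G.
Hypothesis x_dense : forall x e, 0 < e -> exists n, gdist x (x_ n) < e.

Lemma semigroup_path_extension : exists F : (Omega -> R) -> R,
  convex_expectation_space F /\ forall f, M f -> F f = E0 f.
Proof.
apply: (expectation_extension (@cylinder_lattice R G)
  (path_expectation_convex E_convex E_add)) => L a Llin Lle Lcst Ldom.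
apply: (dominated_daniell G_complete x_dense semigroup_expectation_above
  (a := a) Llin Lle Lcst) => t f t0 Bf.
rewrite -path_expectation_coordinate//; apply: Ldom.
exact: coordinate_cylinder.
Qed.

Variable F : (Omega -> R) -> R.
Hypothesis HF : convex_expectation_space F.
Hypothesis FE : forall f, M f -> F f = E0 f.

Let X (t : R) (w : Omega) : G := w t.

Let M_Linfty (f : Omega -> R) : M f -> Linfty f.
Proof. exact: lattice_Linfty (@cylinder_lattice R G) f. Qed.

Lemma coordinate_expectation t f : 0 <= t -> BUC f ->
  F (fun w => f (X t w)) = E t f.
Proof.
move=> t0 Bf; rewrite FE; last exact: coordinate_cylinder.
exact: path_expectation_coordinate.
Qed.

Lemma increasing_expectation (f_ : nat -> Omega -> R) (f : Omega -> R) C :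
  (forall n, M (f_ n)) -> (forall w, `|f w| <= C) ->
  (forall w, increases_to (f_^~ w) (f w)) ->
  Linfty f /\ increases_to (fun n => F (f_ n)) (F f).
Proof.
move=> Mf fC ff; have Lf : Linfty f by apply: Linfty_lim fC ff => n; exact: M_Linfty.
by split=> //; apply: (space_continuous_from_below HF) => // n; exact: M_Linfty.
Qed.

Lemma coordinate_lower_Linfty t (f : G -> R) C : 0 <= t -> (forall x, `|f x| <= C) ->
  (forall x e, 0 < e -> exists2 d, 0 < d & forall y, gdist x y < d -> f x - e <= f y) ->
  Linfty (fun w : Omega => f (X t w)).
Proof.
move=> t0 fC fl; have [f_ [Bf_ ff]] := BUC_approximation_below fC fl.
apply: (increasing_expectation (f_ := fun n w => f_ n (X t w)) (C := C) _ _ _).1.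
- by move=> n; exact: coordinate_cylinder.
- by move=> w; exact: fC.
- by move=> w; exact: ff.
Qed.

(** The sigma-algebra is generated by cylinder functions, not by the coordinates. The indicator of
    an open set is an increasing limit of [BUC] functions, and these become cylinder functions when
    composed with [X t]. *)
Lemma coordinate_measurable t : 0 <= t ->
  measurable_fun [set: Omega]
    (X t : Omega -> g_sigma_algebraType (open : set (set G))).
Proof.
move=> t0; apply: (@measurability _ _ _ (g_sigma_algebraType (open : set (set G)))
  [set: Omega] (X t) open) => [//|_ [U oU <-]].
rewrite setTI; pose f (x : G) : R := \1_U x.
have fl x e : 0 < e -> exists2 d, 0 < d & forall y, gdist x y < d -> f x - e <= f y.
  move=> e0; have [Ux|nUx] := pselect (U x); last first.
    exists 1 => // y _; rewrite /f !indicE memNset// sub0r.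
    by apply: le_trans (ler0n _ _); rewrite oppr_le0 ltW.
  have /nbhs_ballP[d d0 dP] := open_nbhs_nbhs (conj oU Ux).
  exists d => // y xy; rewrite /f !indicE !mem_set//; last exact: dP.
  by rewrite gerBl ltW.
have f1 x : `|f x| <= 1.
  by rewrite /f indicE; case: (_ \in _); rewrite /= ?normr1 ?normr0.
have /LinftyP[mf _] := coordinate_lower_Linfty t0 f1 fl.
have := mf measurableT `]0, +oo[%classic (measurable_itv _); rewrite setTI.
congr measurable; apply/seteqP; split=> w; rewrite /= in_itv/= andbT /f indicE.
  by case: (boolP (_ \in _)) => [/set_mem//|_]; rewrite ltxx.
by move=> Uw; rewrite mem_set.
Qed.

Lemma coordinate_expectation_approximation t (f : G -> R) : 0 <= t -> Cb f ->
  exists f_ : nat -> G -> R, [/\ forall n, BUC (f_ n),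
    forall x, increases_to (f_^~ x) (f x) &
    increases_to (fun n => E t (f_ n)) (F (fun w => f (X t w)))].
Proof.
move=> t0 Cf; have [f_ [Bf_ ff]] := Cb_approximation_below Cf.
have /bounded_fun_leP[C fC] := Cf.2.
exists f_; split=> //.
rewrite (_ : (fun n => E t (f_ n)) = (fun n => F (fun w => f_ n (X t w)))).
  apply: (increasing_expectation (f_ := fun n w => f_ n (X t w)) (C := C) _ _ _).2.
  - by move=> n; exact: coordinate_cylinder.
  - by move=> w; exact: fC.
  - by move=> w; exact: ff.
by apply/funext => n; rewrite coordinate_expectation.
Qed.

Lemma increment_expectation_BUC s t (f : G -> R) : 0 <= s -> 0 <= t -> BUC f ->
  M (fun w => f (increment X s (s + t) w)) /\
  F (fun w => f (increment X s (s + t) w)) = E t f.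
Proof.
move=> s0 t0 Bf; have [fu [C fC]] := (BUC_P f).1 Bf.
have Jf : cylinder_kernel_on (rcons [::] s) (fun=> f : G -> R).
  split; last by exists C.
  by move=> e /fu[d d0 dP]; exists d => // w w' z z' _; exact: dP.
have ps : path <=%R 0 (rcons [::] s) by rewrite /= s0.
have ss : s \in rcons [::] s by rewrite inE.
have Mf : M (fun w => f (increment X s (s + t) w)).
  exists (rcons (rcons [::] s) (s + t)); first exact: path_rcons_increment.
  exact: cylinder_kernel_increment Jf ss.
split=> //; rewrite FE//.
rewrite (path_expectation_increment E_convex E_0 E_add ps t0 Jf).
exact: (Defs.expectation_cst (path_expectation_convex E_convex E_add)).
Qed.

(** Independence for Lipschitz [f], together with the memberships in [M] that allow both sides to
    pass to increasing limits. *)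
Lemma increment_expectation n (ts : 'I_n -> R) s t (f : 'rV[G]_n * G -> R)
    (k : nat) C :
  (forall i, 0 <= ts i <= s) -> (forall i j : 'I_n, (i < j)%N -> ts i < ts j) ->
  0 <= s -> 0 <= t ->
  (forall z z', `|f z - f z'| <= k%:R * rv_dist z z') -> (forall z, `|f z| <= C) ->
  let Y (w : Omega) := \row_(i < n) X (ts i) w in
  [/\ M (fun w => f (Y w, increment X s (s + t) w)),
      M (fun w => E t (fun z => f (Y w, z))),
      F (fun w => f (Y w, increment X s (s + t) w)) =
        F (fun w => E t (fun z => f (Y w, z))) &
      forall y, M (fun w => f (y, increment X s (s + t) w)) /\
        F (fun w => f (y, increment X s (s + t) w)) = E t (fun z => f (y, z))].
Proof.
move=> ts_s ts_lt s0 t0 fl fC Y.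
pose l := [seq ts i | i <- enum 'I_n].
have l_path : path <=%R 0 (rcons l s).
  rewrite le_path_sortedE; apply/andP; split.
    rewrite all_rcons s0; apply/allP => _ /mapP[i _ ->].
    by have /andP[] := ts_s i.
  have l_sorted : sorted <=%R l.
    rewrite /l sorted_map; apply: (@sub_sorted _ (relpre val ltn)).
      by move=> i j ij; apply/ltW/ts_lt.
    by rewrite -sorted_map val_enum_ord iota_ltn_sorted.
  rewrite -(rev_sorted _ (rcons _ _)) rev_rcons /= path_sortedE; last first.
    by move=> x y z xy yz; exact: le_trans yz xy.
  rewrite rev_sorted l_sorted andbT all_rev; apply/allP => _ /mapP[i _ ->].
  by have /andP[] := ts_s i.
pose H (w : path_space) z := f (\row_(i < n) w (ts i), z).
(* [n] coordinates and one increment, each moving by at most [d], change [f] by at most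
   [k * (n + 1) * d]; the final [+ 1] keeps the divisor positive. *)
have n1 : 0 < k%:R * (n%:R + 1) + 1 :> R by rewrite ltr_wpDl// mulr_ge0// addr_ge0.
(* Stated for a general row [y], to serve both the row of coordinates and a constant row. *)
have kH J (y : path_space -> 'rV[G]_n) : (forall w w' d i, (forall u, u \in J -> gdist (w u) (w' u) < d) ->
      0 < d -> gdist (y w 0 i) (y w' 0 i) <= d) ->
    cylinder_kernel_on J (fun w z => f (y w, z)).
  move=> yP; split; last by exists C => w z; exact: fC.
  move=> e e0; pose d := e / (k%:R * (n%:R + 1) + 1).
  have d0 : 0 < d by rewrite divr_gt0.
  exists d => // w w' z z' ww' zz'; apply: (le_trans (fl _ _)).
  have : rv_dist (y w, z) (y w', z') <= (n%:R + 1) * d.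
    rewrite /rv_dist /= mulrDl mul1r; apply: lerD; last exact: ltW.
    apply: (@le_trans _ _ (\sum_(i < n) d)).
      by apply: ler_sum => i _; exact: yP ww' d0.
    by rewrite sumr_const card_ord mulr_natl.
  move=> /(ler_wpM2l (ler0n R k)) /le_trans; apply; rewrite mulrA.
  have : (k%:R * (n%:R + 1) + 1) * d = e by rewrite /d mulrC divfK// gt_eqF.
  by intro_lra.
have JH : cylinder_kernel_on (rcons l s) H.
  apply: kH => w w' d i ww' d0; rewrite !mxE; apply/ltW/ww'.
  by rewrite mem_rcons inE map_f ?orbT// mem_enum.
have sl : s \in rcons l s by rewrite mem_rcons inE eqxx.
have MH : M (fun w => f (Y w, increment X s (s + t) w)).
  exists (rcons (rcons l s) (s + t)); first exact: path_rcons_increment.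
  exact: cylinder_kernel_increment JH sl.
have MEH : M (fun w => E t (fun z => f (Y w, z))).
  exists (rcons l s) => //.
  exact: (cylinder_kernel_expectation E_convex t0 JH).
split=> // [|y].
  rewrite !FE//.
  exact: (path_expectation_increment E_convex E_0 E_add l_path t0 JH).
have By : BUC (fun z => f (y, z)).
  apply: (@cylinder_kernel_BUC _ _ [::] (fun _ z => f (y, z)) (cst 0)).
  by apply: (kH _ (fun=> y)) => w w' d i _ d0; rewrite gdistxx ltW.
exact: (increment_expectation_BUC s0 t0 By).
Qed.

Lemma coordinate_Levy_process : Levy_process F X.
Proof.
split.
- exact: coordinate_measurable.
- move=> f Cf; have [f_ [Bf_ ff Ff]] := coordinate_expectation_approximation (lexx 0) Cf.
  apply: increases_to_unique Ff _; have := ff 0; congr increases_to.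
  by apply/funext => n; rewrite semigroup_expectation0.
- move=> s t s0 t0 f Cf.
  have [f_ [Bf_ ff Ff]] := coordinate_expectation_approximation t0 Cf.
  have /bounded_fun_leP[C fC] := Cf.2.
  have [_ ] := increasing_expectation
    (f_ := fun n w => f_ n (increment X s (s + t) w))
    (fun n => (increment_expectation_BUC s0 t0 (Bf_ n)).1) (fun w => fC _)
    (fun w => ff _).
  move=> lhs; apply: increases_to_unique _ Ff; move: lhs; congr increases_to.
  by apply/funext => n; have [] := increment_expectation_BUC s0 t0 (Bf_ n).
- move=> s t s0 t0 n ts ts_s ts_lt f Cf.
  have [C [f_ [f_l f_C fC ff]]] := Cb_rv_approximation_below Cf.
  pose Y (w : Omega) := \row_(i < n) X (ts i) w.
  pose Z := increment X s (s + t).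
  have I k := increment_expectation ts_s ts_lt s0 t0 (f_l k) (f_C k).
  have [_ lhs] := increasing_expectation (f_ := fun k w => f_ k (Y w, Z w))
    (fun k => let: And4 h _ _ _ := I k in h) (fun w => fC (Y w, Z w))
    (fun w => ff (Y w, Z w)).
  (* For each [y] the inner expectation is the increasing limit of [E t (fun z => f_ k (y, z))].
     With [Y w] for [y] these are cylinder functions, so continuity from below applies a second
     time, to the outer expectation. *)
  have inner y : Linfty (fun w => f (y, Z w)) /\
      increases_to (fun k => E t (fun z => f_ k (y, z))) (F (fun w => f (y, Z w))).
    rewrite (_ : (fun k => E t _) = (fun k => F (fun w => f_ k (y, Z w)))).
      apply: (increasing_expectation (f_ := fun k w => f_ k (y, Z w))
        _ (fun w => fC (y, Z w)) (fun w => ff (y, Z w))) => k.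
      by have [_ _ _ /(_ y)[]] := I k.
    by apply/funext => k; have [_ _ _ /(_ y)[_ ->]] := I k.
  have HC y : `|F (fun w => f (y, Z w))| <= C.
    have [LfZ _] := inner y.
    have Fc c := Defs.expectation_cst (space_expectation HF) c.
    rewrite ler_norml -[leLHS]Fc -[X in _ && (_ <= X)]Fc; apply/andP; split.
      apply: (expectation_monotone (space_expectation HF)) => // [|w].
        exact: Linfty_cst.
      by have := fC (y, Z w); rewrite ler_norml => /andP[].
    apply: (expectation_monotone (space_expectation HF)) => // [|w].
      exact: Linfty_cst.
    by have := fC (y, Z w); rewrite ler_norml => /andP[].
  have [_ rhs] := increasing_expectation
    (f_ := fun k w => E t (fun z => f_ k (Y w, z)))
    (fun k => let: And4 _ h _ _ := I k in h) (fun w => HC (Y w))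
    (fun w => (inner (Y w)).2).
  apply: increases_to_unique lhs _; move: rhs; congr increases_to.
  by apply/funext => k; have [_ _ -> _] := I k.
- move=> f Cf; apply/cvgrPdist_le => e e0.
  have e20 : 0 < e / 2 by rewrite divr_gt0.
  (* Convergence as [t] tends to [0] is known on [BUC] only, so [f] is squeezed between [f_ m] and
     [- g_ n], both within [e / 2] of [f] at [0]. The upper function comes from approximating [- f]
     from below. *)
  have CNf : Cb (fun x => - f x).
    split; last by apply/bounded_fun_leP; have /bounded_fun_leP[C fC] := Cf.2;
      exists C => x; rewrite normrN.
    have [cf _] := Cf; move=> x; have FF : Filter (nbhs x) := nbhs_filter x.
    by apply: (@cvgN _ _ _ (nbhs x) FF f (f x)); exact: cf.
  have [f_ [Bf_ ff]] := Cb_approximation_below Cf.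
  have [g_ [Bg_ gf]] := Cb_approximation_below CNf.
  have /increases_toP[_ _ /(_ _ e20)[m fm]] := ff 0.
  have /increases_toP[_ _ /(_ _ e20)[n gn]] := gf 0.
  have BNg : BUC (fun x => - g_ n x).
    move: (BUC_affine (-1) 0 (Bg_ n)); congr BUC.
    by apply/funext => x; rewrite addr0 mulN1r.
  have Hf := (cvgrPdist_le _ _).1 (semigroup_expectation_cvg0 (Bf_ m)) _ e20.
  have Hg := (cvgrPdist_le _ _).1 (semigroup_expectation_cvg0 BNg) _ e20.
  near=> t.
  have t0' : 0 <= t by near: t; exact: nbhs_right_ge.
  have : `|- g_ n 0 - E t (fun x => - g_ n x)| <= e / 2 by near: t; exact: Hg.
  have : `|f_ m 0 - E t (f_ m)| <= e / 2 by near: t; exact: Hf.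
  have Lf (h : G -> R) : BUC h -> Linfty (fun w : Omega => h (X t w)).
    by move=> Bh; apply: M_Linfty; exact: coordinate_cylinder.
  have Lft : Linfty (fun w : Omega => f (X t w)).
    have /bounded_fun_leP[C fC] := Cf.2.
    by apply: (increasing_expectation (f_ := fun n w => f_ n (X t w))
      (fun n => coordinate_cylinder t0' (Bf_ n)) (fun w => fC _) (fun w => ff _)).1.
  have lo : E t (f_ m) <= law F (X t) f.
    rewrite -coordinate_expectation//.
    apply: (expectation_monotone (space_expectation HF)) => // [|w].
      exact: Lf.
    by have /increases_toP[] := ff (X t w).
  have hi : law F (X t) f <= E t (fun x => - g_ n x).
    rewrite -coordinate_expectation//.
    apply: (expectation_monotone (space_expectation HF)) => // [|w].
      exact: (Lf (fun x => - g_ n x)).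
    by have /increases_toP[_ /(_ n) + _] := gf (X t w); intro_lra.
  rewrite !ler_norml => /andP[? ?] /andP[? ?]; apply/andP.
  by split; intro_lra.
Unshelve. all: by end_near. Qed.

End semigroup_levy_process.

(** * The semigroup of a Levy process *)

Section levy_process_semigroup.
Variables (R : realType) (G : invariantMetricGroup R).
Variables (d : measure_display) (Omega : measurableType d).
Variables (E : (Omega -> R) -> R) (X : R -> Omega -> G).
Hypotheses (HE : convex_expectation_space E) (HX : Levy_process E X).

Let S (t : R) (f : G -> R) (x : G) : R := E (fun w => f (x + X t w)).

Lemma process_Linfty t (f : G -> R) : 0 <= t -> BUC f -> Linfty (fun w => f (X t w)).
Proof.
move=> t0 Bf; have [_ [C fC]] := (BUC_P f).1 Bf.
apply/LinftyP; split; last by exists C.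
apply: (measurability (@RGenOInfty.G R)); first exact: RGenOInfty.measurableE.
move=> _ [_ [x ->] <-].
have [cf _] := BUC_Cb Bf.
have mU : measurable (f @^-1` `]x, +oo[%classic :
    set (g_sigma_algebraType (open : set (set G)))).
  apply: sub_sigma_algebra; apply: open_comp => [y _|]; first exact: cf.
  exact: interval_open.
exact: (Levy_measurable HX t0 measurableT mU).
Qed.

Let E_affine := @Linfty_affine R d Omega.

Let E_dist_le (Y Z : Omega -> R) c := @expectation_dist_le R Omega _ E E_affine
  (space_expectation HE) Y Z c.

Lemma process_semigroup_BUC t f : 0 <= t -> BUC f -> BUC (S t f).
Proof.
move=> t0 Bf; have [fu [C fC]] := (BUC_P f).1 Bf.
have Lf x : Linfty (fun w => f (x + X t w)).
  exact: (process_Linfty t0 (BUC_translate x Bf)).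
apply/BUC_P; split.
  move=> e /fu[r r0 rP]; exists r => // x y xy; apply: E_dist_le => // w.
  by apply: rP; rewrite gdistDr.
exists C => x; have := E_dist_le (Lf x) (Linfty_cst _ 0).
rewrite (Defs.expectation_cst (space_expectation HE)) => /(_ C).
by rewrite subr0; apply => w; rewrite subr0.
Qed.

Lemma process_convolution t : 0 <= t -> convex_Markovian_convolution (S t).
Proof.
move=> t0; have Lf (f : G -> R) x : BUC f -> Linfty (fun w => f (x + X t w)).
  by move=> Bf; exact: (process_Linfty t0 (BUC_translate x Bf)).
split; first split.
- by move=> f; exact: process_semigroup_BUC.
- move=> x; split.
  + move=> f g Bf Bg fg; apply: (expectation_monotone (space_expectation HE));
      [exact: Lf|exact: Lf|by move=> w; exact: fg].
  + by move=> c; exact: (Defs.expectation_cst (space_expectation HE)).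
  + move=> f g l Bf Bg l01.
    exact: (Defs.expectation_convex (space_expectation HE) (Lf f x Bf) (Lf g x Bg) l01).
- move=> f_ f Bf_ Bf ff x; apply: (space_continuous_from_below HE).
  + by move=> n; exact: Lf.
  + exact: Lf.
  + by move=> w; exact: ff.
- move=> f x Bf; rewrite /S; congr E; apply/funext => w.
  by rewrite add0r.
Qed.

Lemma process_semigroupD s t f : 0 <= s -> 0 <= t -> BUC f ->
  S (s + t) f = S s (S t f).
Proof.
move=> s0 t0 Bf; apply/funext => x.
pose ts (i : 'I_1) := s.
have ts_s i : 0 <= ts i <= s by rewrite /ts s0 lexx.
have ts_lt (i j : 'I_1) : (i < j)%N -> ts i < ts j by rewrite !ord1.
(* Conditioning on the single time [s] is enough: [X (s + t)] is [X s] plus the increment.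
   Stationarity then turns the inner expectation into [S t f (x + X s w)]. *)
pose g (z : 'rV[G]_1 * G) := f (x + z.1 0 0 + z.2).
have Cg : Cb g.
  have [fu [C fC]] := (BUC_P f).1 Bf; split; last first.
    by apply/bounded_fun_leP; exists C => z; exact: fC.
  move=> z; have FF : Filter (nbhs z) := nbhs_filter z.
  apply/(@cvgrPdist_le _ _ _ (nbhs z) FF) => e /fu[r r0 rP].
  have r20 : 0 < r / 2 by rewrite divr_gt0.
  apply/nbhs_ballP; exists (r / 2) => // z' [[_ /(_ 0 0) z1] z2]; apply: rP.
  apply: (le_lt_trans (gdist_triangle (x + z'.1 0 0 + z.2) _ _)).
  by rewrite gdistDr !gdistDl [ltRHS]splitr; apply: ltrD.
have := Levy_independent HX s0 t0 ts_s ts_lt Cg.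
rewrite /g /= => H.
rewrite /S (_ : (fun w => f (x + X (s + t) w)) =
  (fun w => f (x + (\row_(i < 1) X (ts i) w) 0 0 + increment X s (s + t) w))).
  rewrite H; congr E; apply/funext => w.
  rewrite mxE; have := Levy_stationary HX s0 t0.
  exact: (fun K => K _ (BUC_Cb (BUC_translate (x + X (ts 0) w) Bf))).
apply/funext => w; rewrite mxE /ts /increment -addrA; congr (f (x + _)).
by rewrite addrC subrK.
Qed.

(* The modulus [m y = sup_x |f (x + y) - f x|] is in [Cb], vanishes at [0] and
   controls [S t f - f] uniformly. *)
Lemma process_semigroup_cvg0 (f : G -> R) : BUC f ->
  sup_norm (fun x => S t f x - f x) @[t --> 0^'+] --> (0 : R).
Proof.
move=> Bf; have [fu [C fC]] := (BUC_P f).1 Bf.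
pose A y := range (fun x => `|f (x + y) - f x|).
pose m y := sup (A y).
have A_ub y : ubound (A y) (C + C).
  by move=> _ [x _ <-]; apply: (le_trans (ler_normB _ _)); exact: lerD.
have m_ge x y : `|f (x + y) - f x| <= m y.
  by apply: ub_le_sup; [exists (C + C)|exists x].
have m_le y c : (forall x, `|f (x + y) - f x| <= c) -> m y <= c.
  move=> H; apply: ge_sup; first by exists `|f (0 + y) - f 0|, 0.
  by move=> _ [x _ <-]; exact: H.
have m0 : m 0 = 0.
  apply/le_anti/andP; split.
    by apply: m_le => x; rewrite addr0 subrr normr0.
  by apply: le_trans (m_ge 0 0).
have Bm : BUC m.
  apply/BUC_P; split; last first.
    exists (C + C) => y; rewrite ger0_norm; last exact: le_trans (m_ge 0 y).
    by apply: m_le => x; apply: A_ub; exists x.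
  move=> e /fu[r r0 rP]; exists r => // y z yz.
  have half y' z' : gdist y' z' < r -> m y' - m z' <= e.
    move=> yz'; rewrite lerBlDl; apply: m_le => x.
    have := m_ge x z'; have := rP (x + y') (x + z').
    rewrite gdistDl => /(_ yz').
    rewrite !ler_norml => /andP[? ?] /andP[? ?]; apply/andP.
    by split; intro_lra.
  by rewrite ler_norml half// andbT lerNl opprB half// gdistC.
(* Without linearity [E (- m)] is not [- E m]: the upper estimate of [S t f - f] uses [m], the lower
   one [- m]. *)
have BNm : BUC (fun y => - m y).
  move: (BUC_affine (-1) 0 Bm); congr BUC.
  by apply/funext => x; rewrite addr0 mulN1r.
apply/cvgrPdist_le => e e0.
have Hm := (cvgrPdist_le _ _).1 (Levy_cvg0 HX (BUC_Cb Bm)) e e0.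
have HNm := (cvgrPdist_le _ _).1 (Levy_cvg0 HX (BUC_Cb BNm)) e e0.
near=> t.
have t0 : 0 <= t by near: t; exact: nbhs_right_ge.
have Lm := process_Linfty t0 Bm.
have LNm := process_Linfty t0 BNm.
have : `|m 0 - law E (X t) m| <= e by near: t; exact: Hm.
have : `|- m 0 - law E (X t) (fun y => - m y)| <= e by near: t; exact: HNm.
rewrite m0 !ler_norml => /andP[_ lo] /andP[hi _].
rewrite /sup_norm sub0r; set s := sup _.
suff : 0 <= s <= e by move=> /andP[? ?]; apply/andP; split; intro_lra.
have bound x : `|S t f x - f x| <= e.
  have Lfx : Linfty (fun w => f (x + X t w)).
    exact: (process_Linfty t0 (BUC_translate x Bf)).
  have up : S t f x <= law E (X t) m + f x.
    apply: (expectation_le_shift E_affine (space_expectation HE)) => // w.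
    by have := m_ge x (X t w); rewrite ler_norml => /andP[_]; intro_lra.
  have dn : law E (X t) (fun y => - m y) <= S t f x + - f x.
    apply: (expectation_le_shift E_affine (space_expectation HE)) => // w.
    by have := m_ge x (X t w); rewrite ler_norml => /andP[? _]; intro_lra.
  by rewrite ler_norml; apply/andP; split; intro_lra.
have s_ub : has_ubound (range (fun x => `|S t f x - f x|)).
  by exists e => _ [x _ <-].
apply/andP; split.
  by apply: (@le_trans _ _ `|S t f 0 - f 0|) => //; apply: ub_le_sup => //; exists 0.
apply: ge_sup; first by exists `|S t f 0 - f 0|, 0.
by move=> _ [x _ <-].
Unshelve. all: by end_near. Qed.

Lemma process_semigroup : convex_Markovian_convolution_semigroup S.
Proof.
split.
- by move=> t; exact: process_convolution.
- move=> f Bf; apply/funext => x.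
  have := Levy0 HX (BUC_Cb (BUC_translate x Bf)).
  by rewrite addr0.
- by move=> s t f; exact: process_semigroupD.
- by move=> f; exact: process_semigroup_cvg0.
Qed.

End levy_process_semigroup.

Theorem theorem2p3 (R : realType) (G : invariantMetricGroup R)
    (G_separable : separable G) (G_complete : complete G) :
  (forall S : R -> (G -> R) -> G -> R,
     convex_Markovian_convolution_semigroup S ->
     (forall t : R, 0 <= t -> continuous_from_above (S t)) ->
     exists (d : measure_display) (Omega : measurableType d)
            (E : (Omega -> R) -> R) (X : R -> Omega -> G),
       [/\ convex_expectation_space E,
           Levy_process E X &
           forall (t : R) (f : G -> R) (x : G), 0 <= t -> BUC f ->
             S t f x = E (fun w => f (x + X t w))])
  /\
  (forall (d : measure_display) (Omega : measurableType d)
          (E : (Omega -> R) -> R) (X : R -> Omega -> G),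
     convex_expectation_space E -> Levy_process E X ->
     convex_Markovian_convolution_semigroup
       (fun (t : R) (f : G -> R) (x : G) => E (fun w => f (x + X t w)))).
Proof.
split=> [S HS S_above|d Omega E X HE HX]; last exact: process_semigroup.
have [x_ x_dense] := separable_sequence G_separable.
have [F [HF FE]] := semigroup_path_extension HS S_above G_complete x_dense.
exists _, _, F, (fun t w => w t); split=> //.
  exact: (coordinate_Levy_process HS HF FE).
move=> t f x t0 Bf; rewrite (semigroup_translation HS)//.
by rewrite -(coordinate_expectation HS FE t0 (BUC_translate x Bf)).
Qed.
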